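(* Let $m, N$ be positive integers and let $A = (a_{ji})$ be an $m \times N$ random matrix whose entries $a_{ji}$, $j \in [m]$, $i \in [N]$, are independent, symmetric, unit-variance random variables, all distributed as a random variable $X$. \begin{enumerate} \item[(a)] Suppose $X$ fulfills the weak moment assumption of order $\max\{4,\log(m)\}$ with constants $\kappa_1$ and $\gamma \geq 1/2$. Then there exist an absolute constant $c_0$ and constants $\widetilde{C}$ and $D$ such that, whenever $m$ is large enough that $4 e^{4\gamma} c_0^2 \kappa_1^2 \log(m) \leq m$ and $N \geq \max\{\widetilde{C} m, \log^{2\gamma-1}(m)\}$, with probability at least $1 - 2\exp(-2m)$ the matrix $\frac{1}{\sqrt{m}} A$ fulfills the $\ell_1$-quotient property with constant $D$ relative to the clipped $\ell_2$-norm $\|\cdot\|^{(\sqrt{\log(eN/m)})} = \max\{\|\cdot\|_2, \sqrt{\log(eN/m)}\,\|\cdot\|_\infty\}$ on $\mathbb{R}^m$. \item[(b)] Suppose $X$ is super-Gaussian with parameter $0 < \sigma \leq 1$. Then there exist constants $\widetilde{C}$ and $D$ (depending on $\sigma$) such that whenever $N \geq \widetilde{C} m$, with probability at least $1 - 2\exp(-2m)$ the matrix $\frac{1}{\sqrt{m}} A$ fulfills the $\ell_1$-quotient property with constant $D$ relative to the $\ell_2$-norm on $\mathbb{R}^m$. \end{enumerate}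
   Context: All logarithms are natural; $[N] = \{1,\dots,N\}$. For a random variable $X$, $\|X\|_{L_p} = (\mathbb{E}|X|^p)^{1/p}$. Let $X$ be a random variable with $\mathbb{E}[X]=0$ and $\mathbb{E}[X^2]=1$. $X$ is super-Gaussian with parameter $\sigma>0$ if $\mathbb{P}(|\sigma g| > t) \leq \mathbb{P}(|X| > t)$ for all $t>0$, where $g$ is a standard normal random variable. $X$ fulfills the weak moment assumption of order $k$ with constants $\kappa_1$ and $\gamma \geq 1/2$ if $\|X\|_{L_p} \leq \kappa_1 p^{\gamma}$ for all $4 \leq p \leq k$. A matrix $M \in \mathbb{R}^{m\times N}$ has the $\ell_1$-quotient property with constant $d$ relative to a norm $\|\cdot\|$ on $\mathbb{R}^m$ if for every $w \in \mathbb{R}^m$ there exists $u \in \mathbb{R}^N$ with $Mu = w$ and $\|u\|_1 \leq d\, s_*^{1/2} \|w\|$, where $s_* = m/\log(eN/m)$. *)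

(* Defs.v *)
From HB Require Import structures.
From mathcomp Require Import all_boot all_order all_algebra.
From mathcomp Require Import all_classical all_reals all_analysis.
Set Implicit Arguments. Unset Strict Implicit. Unset Printing Implicit Defensive.
Import Order.TTheory GRing.Theory Num.Theory.
Import numFieldNormedType.Exports.
Local Open Scope classical_set_scope.
Local Open Scope ring_scope.

Section defs.
Context {R : realType}.

Definition mutually_independent {d} {T : measurableType d} (P : probability T R)
  (I : finType) (Y : I -> T -> R) : Prop :=
  forall (J : {set I}) (B : I -> set R), (forall i, measurable (B i)) ->
    P (\bigcap_(i in [set i | i \in J]) (Y i @^-1` B i)) =
    (\prod_(i in J) P (Y i @^-1` B i))%E.

Definition symmetric_rv {d} {T : measurableType d} (P : probability T R)
  (Y : T -> R) : Prop :=
  forall B : set R, measurable B ->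
    P (Y @^-1` B) = P ((fun w => - Y w) @^-1` B).

Definition same_distribution {d d'} {T : measurableType d} {T' : measurableType d'}
  (P : probability T R) (Y : T -> R) (P' : probability T' R) (X : T' -> R) : Prop :=
  forall B : set R, measurable B -> P (Y @^-1` B) = P' (X @^-1` B).

Definition centered_unit_variance {d} {T : measurableType d} (P : probability T R)
  (X : {RV P >-> R}) : Prop :=
  ('E_P[X] = 0)%E /\ ('E_P[(fun w => (X w ^+ 2)%R)] = 1)%E.

Definition random_matrix_model {d d'} {T : measurableType d}
  {T' : measurableType d'} (m N : nat) (P : probability T R)
  (a : 'I_m -> 'I_N -> {RV P >-> R}) (P' : probability T' R) (X : {RV P' >-> R})
  : Prop :=
  [/\ mutually_independent P (fun ji : 'I_m * 'I_N => (a ji.1 ji.2 : T -> R)),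
      (forall j i, symmetric_rv P (a j i)),
      (forall j i, same_distribution P (a j i) P' X) &
      centered_unit_variance X].

Definition weak_moment {d} {T : measurableType d} (P : probability T R)
  (X : T -> R) (k kappa1 gamma : R) : Prop :=
  forall p : R, 4 <= p <= k ->
    (Lnorm P p%:E (EFin \o X) <= (kappa1 * p `^ gamma)%:E)%E.

Definition super_gaussian {d} {T : measurableType d} (P : probability T R)
  (X : T -> R) (sigma : R) : Prop :=
  forall t : R, 0 < t ->
    (normal_prob 0 1 [set x : R | (t < `|sigma * x|)%R] <= P [set w | (t < `|X w|)%R])%E.

(** "E holds with probability at least p": E contains a measurable event of
    probability >= p (so no measurability of E itself is presupposed). *)
Definition with_prob_at_least {d} {T : measurableType d} (P : probability T R)
  (E : set T) (p : R) : Prop :=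
  exists F : set T, [/\ measurable F, F `<=` E & (p%:E <= P F)%E].

Definition l1norm n (u : 'cV[R]_n) : R := \sum_(i < n) `|u i ord0|.
Definition l2norm n (w : 'cV[R]_n) : R := Num.sqrt (\sum_(i < n) (w i ord0) ^+ 2).
Definition linfnorm n (w : 'cV[R]_n) : R := \big[Num.max/0]_(i < n) `|w i ord0|.

Definition clipped_norm (alpha : R) n (w : 'cV[R]_n) : R :=
  Num.max (l2norm w) (alpha * linfnorm w).

Definition s_star (m N : nat) : R := m%:R / ln (expR 1 * N%:R / m%:R).

Definition l1_quotient_property (m N : nat) (M : 'M[R]_(m, N)) (D : R)
  (nrm : 'cV[R]_m -> R) : Prop :=
  forall w : 'cV[R]_m, exists u : 'cV[R]_N,
    M *m u = w /\ l1norm u <= D * Num.sqrt (s_star m N) * nrm w.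

Definition scaled_matrix {d} {T : measurableType d} (m N : nat)
  (a : 'I_m -> 'I_N -> T -> R) (w : T) : 'M[R]_(m, N) :=
  (Num.sqrt m%:R)^-1 *: \matrix_(j < m, i < N) a j i w.

End defs.

(* Main.v *)
Require Import Defs.
From HB Require Import structures.
From mathcomp Require Import all_boot all_order all_algebra.
From mathcomp Require Import ring lra zify.
From mathcomp Require Import all_classical all_reals all_analysis.
From mathcomp Require Import measurable_realfun.
Import Order.TTheory GRing.Theory Num.Theory.
Import numFieldNormedType.Exports.
Local Open Scope classical_set_scope.
Local Open Scope ring_scope.
Set Implicit Arguments. Unset Strict Implicit. Unset Printing Implicit Defensive.

(* For fixed [y] and [z] in the (rescaled) unit ball of the norm, tilting the
   coordinates of a column [x] by independent densities correlated with [z] shows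
   that [<x, y> >= c <y, z>] with probability [p] of order [(N/m)^(-1/2)]; only
   [P(|X| > 1/2) > 0] is needed when the entries of [z] are bounded by 1, and a
   Gaussian lower tail otherwise. By Chernoff, for fixed [y], at least [p N / 4]
   columns satisfy this, except with probability [exp(- p N / 4)]; this beats a
   grid of mesh [p / sqrt m], which has [exp (O(m log (1/p)))] points near the
   sphere. An arbitrary [y] is rounded randomly and coordinatewise to the grid:
   the error [<x, y - xi>] then has variance at most [(mesh)^2 |x|^2], so some
   grid point [xi] is good for all but few columns, and no operator norm bound
   is involved. The lower bound on [max_i |<x_i, y>|] is dual to the quotient
   property. Quantizing the entries makes all these probabilities finite sums. *)

(** Both cases run through one set [Z], the unit ball of the norm magnified by
    [al = sqrt (ln (e N / m))]; this factor cancels in [sqrt s_star = sqrt m / al]. The exponent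
    [-1/2] of [N / m] is a choice: tilting towards [s * z] instead of [z] costs a power of
    [exp (C s^2 al^2)], and a small [s] keeps that power below [sqrt (e N / m)], while the final
    constant only grows by [1 / s]. Then [p N / m] has order [sqrt (N / m)] and dominates
    [log (1 / p)] once [N / m] exceeds a constant. Uniformity is needed in [y] and in [z], but only
    [y] gets a net: for each grid point [z] is frozen at a near-maximizer over [Z]. Since rounding
    cannot be controlled on every column at once, columns are counted: the hits must outnumber the
    overlong columns together with those spoiled by rounding. *)

Section product_expectation.
Context {R : realType}.

(** * Finite product measures as weighted sums *)

Definition pmf (V : finType) (q : V -> R) : Prop :=
  (forall a, 0 <= q a) /\ \sum_a q a = 1.

(** The definition takes arbitrary weights [F], so that a change of density is merely another choice
    of [F]. *)
Definition pexp (I V : finType) (F : I -> V -> R) (h : {ffun I -> V} -> R) : R :=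
  \sum_(v : {ffun I -> V}) (\prod_i F i (v i)) * h v.

Context {I V : finType}.
Implicit Types (F : I -> V -> R) (h : {ffun I -> V} -> R).

Lemma pexp_prod F (g : I -> V -> R) :
  pexp F (fun v => \prod_i g i (v i)) = \prod_i \sum_a F i a * g i a.
Proof.
by rewrite /pexp bigA_distr_bigA; apply: eq_bigr => v _; rewrite -big_split.
Qed.

Lemma pexpD F h1 h2 : pexp F (fun v => h1 v + h2 v) = pexp F h1 + pexp F h2.
Proof. by rewrite /pexp -big_split; apply: eq_bigr => v _; rewrite mulrDr. Qed.

Lemma pexpZ F c h : pexp F (fun v => c * h v) = c * pexp F h.
Proof. by rewrite /pexp big_distrr; apply: eq_bigr => v _; rewrite mulrCA. Qed.

Lemma pexp_sum F (J : finType) (h : J -> {ffun I -> V} -> R) :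
  pexp F (fun v => \sum_j h j v) = \sum_j pexp F (h j).
Proof.
by rewrite /pexp exchange_big; apply: eq_bigr => v _; rewrite big_distrr.
Qed.

Lemma eq_pexp F h1 h2 : h1 =1 h2 -> pexp F h1 = pexp F h2.
Proof. by move=> h12; apply: eq_bigr => v _; rewrite h12. Qed.

Lemma pexp_tilt F (f : I -> V -> R) h :
  pexp (fun i a => F i a * f i a) h = pexp F (fun v => (\prod_i f i (v i)) * h v).
Proof. by apply: eq_bigr => v _; rewrite big_split/= mulrA. Qed.

Lemma ler_pexp F h1 h2 : (forall i a, 0 <= F i a) -> (forall v, h1 v <= h2 v) ->
  pexp F h1 <= pexp F h2.
Proof. by move=> F0 h12; apply: ler_sum => v _; rewrite ler_wpM2l ?prodr_ge0. Qed.

Variable F : I -> V -> R.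
Hypothesis Fpmf : forall i, pmf (F i).

Let F_ge0 i a : 0 <= F i a. Proof. by case: (Fpmf i). Qed.
Let F_sum1 i : \sum_a F i a = 1. Proof. by case: (Fpmf i). Qed.

Lemma pexp1 : pexp F (fun=> 1) = 1.
Proof.
rewrite (_ : pexp _ _ = pexp F (fun v => \prod_i (fun=> fun=> 1) i (v i))); last first.
  by apply: eq_pexp => v; rewrite big1.
by rewrite (pexp_prod F (fun=> fun=> 1)) big1// => i _; under eq_bigr do rewrite mulr1.
Qed.

Lemma pexp_cst c : pexp F (fun=> c) = c.
Proof. by rewrite -[LHS]/(pexp F (fun=> c)) -[in LHS](mulr1 c) pexpZ pexp1 mulr1. Qed.

Lemma pmf_prod : pmf (fun v : {ffun I -> V} => \prod_i F i (v i)).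
Proof.
split=> [v|]; first exact: prodr_ge0.
by rewrite -[RHS]pexp1 /pexp; apply: eq_bigr => v _; rewrite mulr1.
Qed.

Lemma pexp_coord i (g : V -> R) : pexp F (fun v => g (v i)) = \sum_a F i a * g a.
Proof.
pose G k a := if k == i then g a else 1.
rewrite (_ : pexp _ _ = pexp F (fun v => \prod_k G k (v k))); last first.
  apply: eq_pexp => v; rewrite (bigD1 i)//= /G eqxx big1 ?mulr1// => k /negPf ->//.
rewrite pexp_prod (bigD1 i)//= /G eqxx [X in _ * X]big1 ?mulr1// => k /negPf ->.
by under eq_bigr do rewrite mulr1.
Qed.

Lemma pexp_coord2 i j (g1 g2 : V -> R) : i != j ->
  pexp F (fun v => g1 (v i) * g2 (v j)) =
  (\sum_a F i a * g1 a) * (\sum_a F j a * g2 a).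
Proof.
move=> ij; have ji : j != i by rewrite eq_sym.
pose G k a := if k == i then g1 a else if k == j then g2 a else 1.
rewrite (_ : pexp _ _ = pexp F (fun v => \prod_k G k (v k))); last first.
  apply: eq_pexp => v; rewrite (bigD1 i)//= (bigD1 j)//= /G !eqxx (negPf ji).
  by rewrite big1 ?mulr1// => k /andP[/negPf -> /negPf ->].
rewrite pexp_prod (bigD1 i)//= (bigD1 j)//= /G !eqxx (negPf ji).
rewrite [X in _ * (_ * X)]big1 ?mulr1//.
by move=> k /andP[/negPf -> /negPf ->]; under eq_bigr do rewrite mulr1.
Qed.

(** Independence factors the off-diagonal terms; on the diagonal the squared mean is added for free,
    so second moments replace variances. *)
Lemma pexp_sqr_sum (g : I -> V -> R) :
  pexp F (fun v => (\sum_i g i (v i)) ^+ 2) <=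
  \sum_i \sum_a F i a * g i a ^+ 2 + (\sum_i \sum_a F i a * g i a) ^+ 2.
Proof.
pose e i := \sum_a F i a * g i a.
have sqrE (x : I -> R) : (\sum_i x i) ^+ 2 = \sum_i \sum_j x i * x j.
  by rewrite expr2 big_distrl; apply: eq_bigr => i _; rewrite big_distrr.
rewrite (_ : pexp _ _ = \sum_i \sum_j pexp F (fun v => g i (v i) * g j (v j))); last first.
  rewrite (eq_pexp _ (fun v => sqrE (fun i => g i (v i)))) pexp_sum.
  by apply: eq_bigr => i _; rewrite pexp_sum.
rewrite sqrE -big_split/=; apply: ler_sum => i _.
rewrite (bigD1 i)//= [X in _ <= _ + X](bigD1 i)//= addrA lerD//; last first.
  by apply: ler_sum => j ji; rewrite pexp_coord2 1?eq_sym.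
rewrite (pexp_coord i (fun a => g i a * g i a)).
by rewrite lerDl -expr2 sqr_ge0.
Qed.

Lemma pexp_exists_le h : exists v, h v <= pexp F h.
Proof.
apply: contrapT => /forallNP hlt.
have {}hlt v : pexp F h < h v by rewrite ltNge; apply/negP/hlt.
have : 0 < pexp F (fun v => h v - pexp F h).
  have q1 := pmf_prod.2.
  have [v v0] : exists v : {ffun I -> V}, 0 < \prod_i F i (v i).
    apply: contrapT => /forallNP q0; move: q1; rewrite big1 => [/esym/eqP|v _].
      by rewrite oner_eq0.
    by apply/eqP; rewrite eq_le pmf_prod.1 andbT leNgt; apply/negP/q0.
  rewrite /pexp (bigD1 v)//= ltr_wpDr//; last by rewrite mulr_gt0// subr_gt0.
  by apply: sumr_ge0 => w _; rewrite mulr_ge0 ?pmf_prod.1// subr_ge0 ltW.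
by rewrite (pexpD F h (fun=> - pexp F h)) pexp_cst subrr ltxx.
Qed.

End product_expectation.

(** * Chernoff bounds for the number of columns with a property *)

Section tail_of_counts.
Context {R : realType} {N : nat} {V : finType} (q : V -> R) (Q : pred V).
Hypothesis qpmf : pmf q.

Let count (v : {ffun 'I_N -> V}) : R := \sum_i (Q (v i))%:R.

(** Markov's inequality for [exp (- count)]: as [e^(-1) <= 1/2], each factor is at most
    [1 - p / 2]. *)
Lemma count_lower_tail (p k : R) : p <= \sum_a q a * (Q a)%:R ->
  pexp (fun=> q) (fun v => (count v <= k)%R%:R) <= expR (k - p * N%:R / 2).
Proof.
move=> pQ.
apply: (@le_trans _ _ (pexp (fun=> q)
    (fun v => expR k * \prod_i (fun=> fun a => expR (- (Q a)%:R)) i (v i)))).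
  apply: ler_pexp => [_ a|v]; first exact: qpmf.1.
  rewrite -expR_sum -expRD sumrN -/(count v); case: (leP (count v) k) => ck /=; last exact: expR_ge0.
  by rewrite -expR0 ler_expR subr_ge0.
rewrite pexpZ (pexp_prod (fun=> q) (fun=> fun a => expR (- (Q a)%:R))) expRD ler_wpM2l ?expR_ge0// prodr_const card_ord.
rewrite (_ : - _ = - (p / 2) * N%:R); last by lra.
rewrite expRM_natr lerXn2r ?nnegrE ?expR_ge0//.
  by apply: sumr_ge0 => a _; rewrite mulr_ge0 ?qpmf.1 ?expR_ge0.
apply: le_trans (expR_ge1Dx _).
apply: (@le_trans _ _ (\sum_a (q a - q a * (Q a)%:R / 2))).
  apply: ler_sum => a _; have q0 := qpmf.1 a.
  have e2 : expR (- 1) <= 2^-1 :> R.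
    rewrite expRN lef_pV2 ?posrE ?expR_gt0//.
    by have := @expR_ge1Dx R 1; lra.
  by case: (Q a) => /=; [nra|rewrite oppr0 expR0; lra].
by rewrite sumrB qpmf.2 -big_distrl/=; lra.
Qed.

(** Exponent [1 / 2] here, since [e^(1/2) <= 2] bounds each factor by [1 + p]. *)
Lemma count_upper_tail (p k : R) : \sum_a q a * (Q a)%:R <= p ->
  pexp (fun=> q) (fun v => (k <= count v)%R%:R) <= expR (p * N%:R - k / 2).
Proof.
move=> pQ.
apply: (@le_trans _ _ (pexp (fun=> q)
    (fun v => expR (- (k / 2)) * \prod_i (fun=> fun a => expR ((Q a)%:R / 2)) i (v i)))).
  apply: ler_pexp => [_ a|v]; first exact: qpmf.1.
  rewrite -expR_sum -expRD -big_distrl/= -/(count v).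
  case: (leP k (count v)) => ck /=; last exact: expR_ge0.
  by rewrite -[leLHS]expR0 ler_expR; lra.
rewrite pexpZ (pexp_prod (fun=> q) (fun=> fun a => expR ((Q a)%:R / 2))) mulrC [in leRHS]expRD ler_wpM2r ?expR_ge0// prodr_const card_ord.
rewrite expRM_natr lerXn2r ?nnegrE ?expR_ge0//.
  by apply: sumr_ge0 => a _; rewrite mulr_ge0 ?qpmf.1 ?expR_ge0.
apply: le_trans (expR_ge1Dx _).
apply: (@le_trans _ _ (\sum_a (q a + q a * (Q a)%:R))).
  apply: ler_sum => a _; have q0 := qpmf.1 a.
  have e2 : expR (1 / 2) <= 2 :> R.
    rewrite -[leLHS]invrK -expRN -[leRHS]invrK lef_pV2 ?posrE ?invr_gt0 ?expR_gt0//.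
    by have := @expR_ge1Dx R (- (1 / 2)); lra.
  by case: (Q a) => /=; [nra|rewrite mul0r expR0; lra].
by rewrite big_split/= qpmf.2; lra.
Qed.

End tail_of_counts.

(** * Change of density and lower tails of sums *)

Section tilting.
Context {R : realType}.

(** The model is a Gaussian shift, whose density has second moment [exp (z ^+ 2)]: with a cost of
    this form, the product over coordinates depends only on [\sum_i z i ^+ 2]. [V0] bounds the
    second moment of [x] under the new law. *)
Definition tiltable (V : finType) (q x : V -> R) (C c V0 z : R) : Prop :=
  exists f : V -> R,
    [/\ forall a, 0 <= f a, \sum_a q a * f a = 1,
        \sum_a q a * f a ^+ 2 <= expR (C * z ^+ 2),
        \sum_a q a * f a * x a = c * z &
        \sum_a q a * f a * x a ^+ 2 <= V0].

(* Under the density [\prod_i f i (v i)] the sum has mean [M] and variance at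
   most [V0 * \sum_i y i ^+ 2], so by Paley-Zygmund it exceeds [M / 2] with
   probability [t]; Cauchy-Schwarz then bounds the original probability below by
   [t ^+ 2] over the second moment of the density. *)
Lemma tilted_lower_tail (I V : finType) (q x : V -> R) (C c V0 K : R) (y z : I -> R) :
  pmf q -> 0 <= V0 -> 0 <= K -> (forall i, tiltable q x C c V0 (z i)) ->
  let M := c * \sum_i y i * z i in
  0 < M -> \sum_i y i ^+ 2 <= K * M ^+ 2 ->
  (4 * (1 + V0 * K)) ^- 2 * expR (- (C * \sum_i z i ^+ 2)) <=
  pexp (fun=> q) (fun v : {ffun I -> V} => (M / 2 <= \sum_i y i * x (v i))%R%:R).
Proof.
move=> qpmf V00 K0 /choice[f /all_and5[f0 f1 f2 fx fx2]] M M0 yM.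
pose G i a := q a * f i a.
have Gpmf i : pmf (G i) by split=> [a|]; [rewrite mulr_ge0 ?qpmf.1|exact: f1].
pose S (v : {ffun I -> V}) := \sum_i y i * x (v i).
pose E (v : {ffun I -> V}) : R := (M / 2 <= S v)%R%:R.
have ES : pexp G S = M.
  rewrite pexp_sum /M big_distrr/=; apply: eq_bigr => i _.
  rewrite pexpZ (pexp_coord Gpmf i x) /G fx; ring.
have ES2 : pexp G (fun v => S v ^+ 2) <= (1 + V0 * K) * M ^+ 2.
  apply: (le_trans (pexp_sqr_sum Gpmf (fun i a => y i * x a))).
  rewrite mulrDl mul1r addrC lerD//.
    rewrite le_eqVlt; apply/orP; left; apply/eqP; congr (_ ^+ 2).
    rewrite /M big_distrr/=; apply: eq_bigr => i _.
    rewrite (_ : \sum_a _ = y i * \sum_a q a * f i a * x a).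
      by rewrite fx; ring.
    by rewrite big_distrr/=; apply: eq_bigr => a _; rewrite /G; ring.
  apply: (@le_trans _ _ (\sum_i V0 * y i ^+ 2)).
    apply: ler_sum => i _.
    rewrite (_ : \sum_a _ = y i ^+ 2 * \sum_a q a * f i a * x a ^+ 2).
      by rewrite mulrC ler_wpM2r ?sqr_ge0.
    by rewrite big_distrr/=; apply: eq_bigr => a _; rewrite /G; ring.
  by rewrite -big_distrr/= -mulrA ler_wpM2l.
clearbody M; set T := 1 + V0 * K in ES2 *.
have T0 : 0 < T by rewrite ltr_pwDl// mulr_ge0.
clearbody T; have G0 i a : 0 <= G i a by case: (Gpmf i).
have EG : (4 * T)^-1 <= pexp G E.
  (* Cauchy-Schwarz in pointwise form, [S * E <= (l * S ^+ 2 + E / l) / 2], with [S <= M / 2] off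
     the event; this [l] lets the quadratic term use up half of the remaining [M / 2]. *)
  pose l := (2 * T * M)^-1.
  have l0 : 0 < l by rewrite invr_gt0 !mulr_gt0.
  have lTM : l * (2 * T * M) = 1 by rewrite mulVf// gt_eqF// !mulr_gt0.
  have : pexp G S <= pexp G (fun v => M / 2 + (l / 2 * S v ^+ 2 + (2 * l)^-1 * E v)).
    apply: ler_pexp => // v; rewrite /E.
    have l20 : 0 <= l / 2 * S v ^+ 2 by rewrite mulr_ge0 ?sqr_ge0// ltW// divr_gt0.
    case: (leP (M / 2) (S v)) => MS /=; last by rewrite mulr0; lra.
    have lV : (2 * l)^-1 = T * M by rewrite /l; field; rewrite ?gt_eqF.
    rewrite lV mulr1.
    suff : 0 <= l / 2 * (S v - 2 * T * M) ^+ 2.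
      by rewrite sqrrB; move: lTM => /(congr1 (fun r => r * (S v - T * M))); nra.
    by rewrite mulr_ge0 ?sqr_ge0// ltW// divr_gt0.
  rewrite ES pexpD (pexp_cst Gpmf) pexpD !pexpZ => MM.
  have lV : (2 * l)^-1 = T * M by rewrite /l; field; rewrite ?gt_eqF.
  have : l / 2 * pexp G (fun v => S v ^+ 2) <= M / 4.
    apply: (@le_trans _ _ (l / 2 * (T * M ^+ 2))); first by rewrite ler_wpM2l// ltW// divr_gt0.
    by move: lTM => /(congr1 (fun r => r * M)); nra.
  rewrite lV in MM => lM.
  have : M * (1 / 4) <= M * (T * pexp G E) by nra.
  by rewrite ler_pM2l// => ?; rewrite -[leLHS]mul1r ler_pdivrMr ?mulr_gt0//; lra.
set Q := pexp _ _.
set W := expR (C * \sum_i z i ^+ 2).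
have W0 : 0 < W by exact: expR_gt0.
rewrite expRN -/W.
pose d (v : {ffun I -> V}) := \prod_i f i (v i).
have Ed2 : pexp (fun=> q) (fun v => d v ^+ 2) <= W.
  rewrite (@eq_pexp _ _ _ _ _ (fun v => \prod_i (fun i a => f i a ^+ 2) i (v i))); last first.
    by move=> v; rewrite /d -prodrXl.
  rewrite (pexp_prod (fun=> q) (fun i a => f i a ^+ 2)) /W big_distrr/= expR_sum.
  apply: ler_prod => i _; rewrite f2 andbT.
  by apply: sumr_ge0 => a _; rewrite mulr_ge0 ?sqr_ge0 ?qpmf.1.
set t := (4 * T)^-1 in EG *.
have t0 : 0 < t by rewrite invr_gt0 mulr_gt0.
have : pexp G E <= pexp (fun=> q) (fun v => (t / W) / 2 * d v ^+ 2 + (W / t) / 2 * E v).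
  rewrite (pexp_tilt (fun=> q) f); apply: ler_pexp => [_ a|v]; first exact: qpmf.1.
  rewrite -/(d v) /E.
  have tW0 : 0 < t / W by rewrite divr_gt0.
  case: (M / 2 <= S v); rewrite ?mulr1 ?mulr0 ?addr0/=; last first.
    by rewrite mulr_ge0 ?sqr_ge0// ltW// divr_gt0.
  have -> : W / t = (t / W)^-1 by rewrite invf_div.
  suff : 0 <= (t / W) / 2 * (d v - (t / W)^-1) ^+ 2.
    rewrite sqrrB.
    have : t / W * (t / W)^-1 = 1 by rewrite mulfV// gt_eqF.
    by set u := (t / W)^-1; set w := t / W => wu; have := congr1 (fun r => r * u) wu;
       have := congr1 (fun r => r * d v) wu => /=; nra.
  by rewrite mulr_ge0 ?sqr_ge0// ltW// divr_gt0.
rewrite pexpD !pexpZ -/Q => GQ.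
have : t / W / 2 * pexp (fun=> q) (fun v => d v ^+ 2) <= t / 2.
  apply: (@le_trans _ _ (t / W / 2 * W)); first by rewrite ler_wpM2l// ltW// !divr_gt0.
  by rewrite le_eqVlt; apply/orP; left; apply/eqP; field; rewrite gt_eqF.
move=> dQ.
have tQ : t / 2 <= W / t / 2 * Q by lra.
rewrite ler_pdivrMr//.
have : t / 2 * (2 * t) <= W / t / 2 * Q * (2 * t) by rewrite ler_pM2r// mulr_gt0.
rewrite (_ : W / t / 2 * Q * (2 * t) = Q * W); last by field; rewrite gt_eqF.
have -> : (4 * T) ^- 2 = t * t by rewrite -exprVn expr2.
by clearbody t; lra.
Qed.

End tilting.

(** * Random rounding to the grid, and the size of the grid *)

Section rounding.
Context {R : realType}.

Lemma random_rounding (m N : nat) (y : 'I_m -> R) (h B t : R)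
    (X : 'I_N -> 'I_m -> R) (good : pred 'I_N) : 0 < h -> 0 < t -> 0 <= B ->
  (forall i, good i -> \sum_j X i j ^+ 2 <= B) ->
  exists k : 'I_m -> int, (forall j, `|h * (k j)%:~R - y j| <= h) /\
    \sum_i (good i && (t <= `|\sum_j X i j * (y j - h * (k j)%:~R)|)%R)%:R
      <= N%:R * (h ^+ 2 * B / t ^+ 2).
Proof.
move=> h0 t0 B0 XB.
pose fl j := Num.floor (y j / h).
pose r j := y j / h - (fl j)%:~R.
have r0 j : 0 <= r j by rewrite subr_ge0 floor_le.
have r1 j : r j <= 1.
  by rewrite lerBlDr addrC ltW// [X in _ < X](_ : _ = (fl j + 1)%:~R) ?floorD1_gt// intrD.
have hr j : y j = h * (r j + (fl j)%:~R) by rewrite subrK mulrC divfK// gt_eqF.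
(* Rounding up with probability the fractional part is unbiased, so the mean term of [pexp_sqr_sum]
   vanishes. *)
pose F j (b : bool) := if b then r j else 1 - r j.
have Fpmf j : pmf (F j).
  split=> [b|]; last by rewrite big_bool/= addrC subrK.
  by case: b; [exact: r0|rewrite subr_ge0; exact: r1].
pose S i (e : {ffun 'I_m -> bool}) := \sum_j X i j * (h * (r j - (e j)%:R)).
pose cnt (e : {ffun 'I_m -> bool}) : R := \sum_i (good i && (t <= `|S i e|)%R)%:R.
have [e ecnt] := pexp_exists_le Fpmf cnt.
exists (fun j => fl j + (e j : nat)%:Z); split => [j|].
  rewrite intrD [in X in _ - X]hr -mulrBr normrM gtr0_norm// ler_piMr ?(ltW h0)//.
  rewrite (_ : _ - _ = (e j)%:R - r j); last by rewrite pmulrn; ring.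
  by have := r0 j; have := r1 j; case: (e j) => /= ? ?; rewrite ler_norml; lra.
have -> : \sum_i (good i && (t <= `|\sum_j X i j * (y j - h * (fl j + (e j : nat)%:Z)%:~R)|)%R)%:R
    = cnt e.
  apply: eq_bigr => i _; congr (_ && (t <= `|_|))%R%:R.
  by apply: eq_bigr => j _; rewrite intrD [in LHS]hr -pmulrn; ring.
apply: (le_trans ecnt); rewrite /cnt pexp_sum mulr_natl -[in leRHS](card_ord N) -sumr_const.
apply: ler_sum => i _.
have [gi|gi] := boolP (good i); last first.
  rewrite (@eq_pexp _ _ _ _ _ (fun=> 0)); last by [].
  by rewrite (pexp_cst Fpmf) mulr_ge0 ?invr_ge0 ?sqr_ge0// mulr_ge0 ?sqr_ge0.
apply: (@le_trans _ _ (pexp F (fun e => (t ^+ 2)^-1 * S i e ^+ 2))).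
  apply: ler_pexp => [j b|f]; first by case: (Fpmf j).
  rewrite /=; case: (leP t `|S i f|) => /= tS; last by rewrite mulr_ge0 ?invr_ge0 ?sqr_ge0.
  by rewrite mulrC ler_pdivlMr ?exprn_gt0// mul1r -[leRHS]real_normK ?num_real// lerXn2r ?nnegrE// ltW.
rewrite pexpZ mulrC ler_wpM2r ?invr_ge0 ?sqr_ge0//.
apply: (le_trans (pexp_sqr_sum Fpmf (fun j (b : bool) => X i j * (h * (r j - b%:R))))).
rewrite [X in _ + X ^+ 2]big1 ?expr0n ?addr0/=; last first.
  by move=> j _; rewrite big_bool /F/=; ring.
apply: (@le_trans _ _ (\sum_j h ^+ 2 * X i j ^+ 2)); last first.
  by rewrite -big_distrr/= ler_wpM2l ?sqr_ge0// XB.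
apply: ler_sum => j _; rewrite big_bool /F/=.
rewrite [leLHS](_ : _ = (r j * (1 - r j)) * (h ^+ 2 * X i j ^+ 2)); last by ring.
rewrite ler_piMl//; first by rewrite -exprMn sqr_ge0.
by have := r0 j; have := r1 j; nra.
Qed.

Lemma sum_geometric_expR (n : nat) (A : R) : 0 < A ->
  \sum_(i < n) expR (- (i%:R / A)) <= 1 + A.
Proof.
move=> A0; pose t := expR (- A^-1).
have t1 : (1 + A) * t <= A.
  rewrite /t expRN ler_pdivrMr ?expR_gt0//.
  by have := @expR_ge1Dx R A^-1; rewrite -(ler_pM2l A0) mulrDr mulfV ?gt_eqF//; lra.
have t0 : 0 < t by exact: expR_gt0.
rewrite (_ : \sum_(i < n) _ = \sum_(i < n) t ^+ i); last first.
  by apply: eq_bigr => i _; rewrite -expRM_natl mulrN.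
have := subrX1 t n; set s := \sum_(i < n) _ => ts.
have tn : 0 <= t ^+ n by rewrite exprn_ge0// ltW.
have s0 : 0 <= s by apply: sumr_ge0 => i _; rewrite exprn_ge0// ltW.
by nra.
Qed.

(** On the ball [\prod_j exp (1 - |k_j| / A)] is at least 1, and its sum over integer vectors
    factors into geometric series. Coordinates are stored shifted by [B]. An [l1]-ball keeps the
    base free of [m], whereas a cube around a sphere with mesh [eps / sqrt m] would put [sqrt m]
    there. *)
Lemma card_integer_l1_ball (m B : nat) (A : R) : 0 < A ->
  \sum_(n : {ffun 'I_m -> 'I_(B + B.+1)})
    (\sum_j `|(n j)%:R - B%:R| <= A * m%:R :> R)%R%:R
  <= (expR 1 * (1 + 2 * A)) ^+ m.
Proof.
move=> A0.
pose w (k : 'I_(B + B.+1)) : R := expR (1 - `|k%:R - B%:R| / A).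
apply: (@le_trans _ _ (\sum_(n : {ffun 'I_m -> 'I_(B + B.+1)}) \prod_j w (n j))).
  apply: ler_sum => n _.
  rewrite -expR_sum sumrB sumr_const card_ord -big_distrl/=.
  set s := \sum_j `|_|; case: (leP s (A * m%:R)) => [sA|_] /=; last exact: expR_ge0.
  by rewrite -[leLHS]expR0 ler_expR subr_ge0 ler_pdivrMr// mulrC.
rewrite -(bigA_distr_bigA (fun=> w))/= prodr_const card_ord lerXn2r ?nnegrE//.
- by apply: sumr_ge0 => k _; exact: expR_ge0.
- by rewrite mulr_ge0 ?expR_ge0// addr_ge0// mulr_ge0// ltW.
rewrite (_ : \sum_k _ = expR 1 * \sum_(k < B + B.+1) expR (- (`|k%:R - B%:R| / A))); last first.
  by rewrite big_distrr/=; apply: eq_bigr => k _; rewrite -expRD.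
rewrite ler_wpM2l ?expR_ge0// big_split_ord/= [1 + _](_ : _ = A + (1 + A)); last by ring.
rewrite lerD//; last first.
  apply: le_trans (sum_geometric_expR B.+1 A0).
  by apply: ler_sum => i _; rewrite natrD addrC addKr ger0_norm.
rewrite (reindex_inj rev_ord_inj)/=.
rewrite (_ : \sum_j _ = expR (- A^-1) * \sum_(i < B) expR (- (i%:R / A))); last first.
  rewrite big_distrr/=; apply: eq_bigr => i _; rewrite -expRD; congr expR.
  rewrite natrB// distrC opprB addrC subrK ger0_norm// -[i.+1]addn1 natrD.
  by rewrite mulrDl opprD mul1r addrC.
apply: (@le_trans _ _ (expR (- A^-1) * (1 + A))).
  by rewrite ler_wpM2l ?expR_ge0// sum_geometric_expR.
rewrite expRN mulrC ler_pdivrMr ?expR_gt0//.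
by have := @expR_ge1Dx R A^-1; rewrite -(ler_pM2l A0) mulrDr mulfV ?gt_eqF//; lra.
Qed.

End rounding.

Lemma absz_shift (B : nat) (k : int) : (`|k| < B)%N ->
  (absz (B%:Z + k)%R < B + B.+1)%N /\ (absz (B%:Z + k)%R)%:Z = B%:Z + k.
Proof. by move=> kB; split; lia. Qed.

(** * Uniform lower bound for arrays with finitely valued entries *)

Section finite_model.
Context {R : realType}.

Definition dot (I : finType) (y z : I -> R) : R := \sum_j y j * z j.

Lemma dotC (I : finType) (y z : I -> R) : dot y z = dot z y.
Proof. by apply: eq_bigr => j _; rewrite mulrC. Qed.

Lemma dotZl (I : finType) (c : R) (y z : I -> R) : dot (fun j => c * y j) z = c * dot y z.
Proof. by rewrite /dot big_distrr/=; apply: eq_bigr => j _; rewrite mulrA. Qed.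

Lemma dotBl (I : finType) (y1 y2 z : I -> R) :
  dot (fun j => y1 j - y2 j) z = dot y1 z - dot y2 z.
Proof. by rewrite /dot -sumrB; apply: eq_bigr => j _; rewrite mulrBl. Qed.

Lemma dot_ge0 (I : finType) (y : I -> R) : 0 <= dot y y.
Proof. by apply: sumr_ge0 => j _; rewrite -expr2 sqr_ge0. Qed.

Lemma dot_eq0 (I : finType) (y : I -> R) : dot y y = 0 -> forall j, y j = 0.
Proof.
move=> /eqP; rewrite psumr_eq0 => [/allP yy j|j _]; last by rewrite -expr2 sqr_ge0.
by have := yy j (mem_index_enum _); rewrite /= mulf_eq0 orbb => /eqP.
Qed.

Lemma dot_le (I : finType) (a b : I -> R) (A B : R) : 0 < A -> 0 < B ->
  dot a a <= A ^+ 2 -> dot b b <= B ^+ 2 -> dot a b <= A * B.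
Proof.
move=> A0 B0 aA bB.
have : 0 <= dot (fun j => B * a j - A * b j) (fun j => B * a j - A * b j).
  exact: dot_ge0.
rewrite dotBl !dotZl ![dot _ (fun j => _ - _)]dotC !dotBl !dotZl (dotC b a) => AB.
have AB0 : 0 < A * B by rewrite mulr_gt0.
rewrite -(ler_pM2l AB0).
have : B ^+ 2 * dot a a <= B ^+ 2 * A ^+ 2 by rewrite ler_wpM2l ?sqr_ge0.
have : A ^+ 2 * dot b b <= A ^+ 2 * B ^+ 2 by rewrite ler_wpM2l ?sqr_ge0.
by nra.
Qed.

(** [Z] is not assumed closed, so its supremum need not be attained; half of it is enough. *)
Lemma near_maximizer (I : finType) (Z : (I -> R) -> Prop) (al : R) (y : I -> R) :
  Z (fun=> 0) -> (forall z, Z z -> dot z z <= al ^+ 2) ->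
  exists z, Z z /\ forall z', Z z' -> dot y z' <= 2 * dot y z.
Proof.
move=> Z0 Zal; pose E := [set dot y z | z in [set z | Z z]].
have dot0 : dot y (fun=> 0) = 0 by rewrite /dot big1// => j _; rewrite mulr0.
have E0 : E 0 by exists (fun=> 0).
have ubE : ubound E (dot y y + al ^+ 2).
  move=> _ [z Zz <-].
  have : 0 <= dot (fun j => y j - z j) (fun j => y j - z j) by exact: dot_ge0.
  rewrite dotBl ![dot _ (fun j => _ - _)]dotC !dotBl (dotC z y).
  by have := Zal _ Zz; have := dot_ge0 y; have := dot_ge0 z; lra.
have supE : has_sup E by split; [exists 0|exists (dot y y + al ^+ 2)].
have supub z : Z z -> dot y z <= sup E.
  by move=> Zz; apply: sup_upper_bound => //; exists z.
have [s0|s0] := ltP 0 (sup E); last first.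
  by exists (fun=> 0); split => // z /supub; rewrite dot0; lra.
have s20 : 0 < sup E / 2 by lra.
have [_ [z Zz <-] lz] := sup_adherent s20 supE.
by exists z; split=> // z' /supub; lra.
Qed.

Variables (m N : nat) (V : finType) (q x : V -> R) (Z : ('I_m -> R) -> Prop).
Variables (al C c s V0 p : R).
Hypotheses (m_gt0 : (0 < m)%N) (N_gt0 : (0 < N)%N).
Hypotheses (qpmf : pmf q) (qx2 : \sum_a q a * x a ^+ 2 <= 1).
Hypotheses (al1 : 1 <= al) (Zunit : forall y, dot y y <= 1 -> Z y).
Hypothesis (Zal : forall z, Z z -> dot z z <= al ^+ 2).
Hypothesis (Ztilt : forall z, Z z -> forall j, tiltable q x C c V0 (s * z j)).
Hypotheses (C0 : 0 <= C) (c0 : 0 < c) (s0 : 0 < s) (V00 : 0 <= V0) (cs1 : c * s <= 1).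
Hypotheses (p0 : 0 < p) (pal : p * al <= 1).
Hypothesis (ple : p <= (4 * (1 + V0 * (4 / (c * s) ^+ 2))) ^- 2 *
                     expR (- (C * (s ^+ 2 * al ^+ 2)))).
(** To match a value [ka] of [dot y z], a hit supplies at least [7 / 32 * c * s * ka]; smallness at
    [y] and the rounding error may each take [ka / D], a tenth of [c * s * ka], and
    [2 / 10 < 7 / 32]. *)
Let D : R := 10 / (c * s).
(** The first condition pays for the union bound over the grid, the second for the overlong columns;
    each leaves [exp (- 3 m)]. *)
Hypothesis (numeric1 : expR 4 * (1 + 128 * D / p) <= expR (p * (N%:R / m%:R) / 4)).
Hypothesis (numeric2 : 96 <= p * (N%:R / m%:R)).

Let col := {ffun 'I_m -> V}.
Let qc (u : col) : R := \prod_j q (u j).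

Let cs0 : 0 < c * s. Proof. exact: mulr_gt0. Qed.
Let D10 : 10 <= D. Proof. by rewrite /D ler_pdivlMr//; move: cs1; lra. Qed.
Let D0 : 0 < D. Proof. exact: lt_le_trans D10. Qed.
Let mR0 : 0 < m%:R :> R. Proof. by rewrite ltr0n. Qed.
Let p1 : p <= 1. Proof. by move: al1 pal p0; nra. Qed.
Let qcpmf : pmf qc. Proof. exact: (@pmf_prod R 'I_m V (fun=> q)). Qed.

(** As [Z] contains the unit ball, a near-maximizer has [|y| <= 2 * dot y z]. The spread of the
    tilted sum is thus controlled by its mean, with [K = 4 / (c * s) ^+ 2] in
    [tilted_lower_tail]. *)
Lemma column_lower_tail (y z : 'I_m -> R) : 0 < dot y y -> Z z ->
  (forall z', Z z' -> dot y z' <= 2 * dot y z) ->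
  p <= \sum_u qc u * (c * s * dot y z / 2 <= \sum_j y j * x (u j))%R%:R.
Proof.
move=> y0 Zz zmax; set r := Num.sqrt (dot y y).
have r0 : 0 < r by rewrite sqrtr_gt0.
have r2 : r ^+ 2 = dot y y by rewrite sqr_sqrtr// ltW.
have rz : r <= 2 * dot y z.
  have rVr : dot y y = r * r by rewrite -expr2 r2.
  have := zmax (fun j => r^-1 * y j).
  rewrite (dotC y) dotZl rVr mulKf ?gt_eqF//; apply; apply: Zunit.
  by rewrite dotZl dotC dotZl rVr mulKf ?mulVf ?gt_eqF.
have ME : c * \sum_j y j * (s * z j) = c * s * dot y z.
  by rewrite -mulrA; congr (_ * _); rewrite /dot big_distrr/=; apply: eq_bigr => j _; ring.
have M0 : 0 < c * s * dot y z by rewrite mulr_gt0//; lra.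
have := @tilted_lower_tail R 'I_m V q x C c V0 (4 / (c * s) ^+ 2) y (fun j => s * z j)
  qpmf V00 _ (Ztilt Zz).
rewrite /= ME => /(_ _ M0) T; apply: le_trans (T _ _).
- apply: (le_trans ple); rewrite ler_wpM2l ?invr_ge0 ?sqr_ge0// ler_expR lerN2.
  rewrite ler_wpM2l//.
  have -> : \sum_j (s * z j) ^+ 2 = s ^+ 2 * dot z z.
    by rewrite /dot big_distrr/=; apply: eq_bigr => j _; ring.
  by rewrite ler_wpM2l ?sqr_ge0// Zal.
- by rewrite mulr_ge0 ?invr_ge0 ?sqr_ge0.
- have -> : \sum_j y j ^+ 2 = r ^+ 2.
    by rewrite r2; apply: eq_bigr => j _; rewrite expr2.
  rewrite (_ : _ * _ = (2 * dot y z) ^+ 2); last by field; rewrite ?gt_eqF.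
  by rewrite lerXn2r ?nnegrE//; lra.
Qed.

(** Markov's inequality: the mean squared length is at most [m]. Overlong columns are thereby made
    rarer than hits, which have probability at least [p]. *)
Lemma column_norm_tail :
  \sum_u qc u * (32 / p * m%:R < \sum_j x (u j) ^+ 2)%R%:R <= p / 32.
Proof.
apply: (@le_trans _ _ (pexp (fun=> q)
    (fun u : col => p / (32 * m%:R) * \sum_j x (u j) ^+ 2))).
  apply: ler_pexp => [_ a|u]; first exact: qpmf.1.
  have xs0 : 0 <= \sum_j x (u j) ^+ 2 by apply: sumr_ge0 => j _; exact: sqr_ge0.
  have pm0 : 0 < p / (32 * m%:R) by rewrite divr_gt0// mulr_gt0.
  case: ltP => xs /=; last by rewrite mulr_ge0// ltW.
  rewrite [leLHS](_ : _ = p / (32 * m%:R) * (32 / p * m%:R)); last by field; rewrite !gt_eqF.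
  by rewrite ler_wpM2l// ltW.
rewrite pexpZ pexp_sum.
apply: (@le_trans _ _ (p / (32 * m%:R) * \sum_(j < m) 1)).
  rewrite ler_wpM2l//; first by rewrite ltW// divr_gt0// mulr_gt0.
  apply: ler_sum => j _.
  by rewrite (@pexp_coord R 'I_m V (fun=> q) _ j (fun a => x a ^+ 2)).
rewrite sumr_const card_ord le_eqVlt; apply/orP; left; apply/eqP.
by field; rewrite gt_eqF.
Qed.

(** With this mesh, rounding spoils at most [p * N / (32 * ka ^+ 2)] columns and changes the product
    of [y] with a point of [Z] by at most [1 / 8]. *)
Let eps : R := p / (32 * D).
Let h : R := eps / Num.sqrt m%:R.
Let A : R := 2 / eps.
Let B : nat := (Num.truncn (A * m%:R)).+1.
Let net := {ffun 'I_m -> 'I_(B + B.+1)}.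
Let pt (n : net) (j : 'I_m) : R := h * ((n j)%:R - B%:R).
Let in_net (n : net) : bool :=
  (\sum_j `|(n j)%:R - B%:R| <= A * m%:R)%R && (0 < dot (pt n) (pt n)).
Let long (u : col) : bool := (32 / p * m%:R < \sum_j x (u j) ^+ 2)%R.

Let eps0 : 0 < eps. Proof. by rewrite divr_gt0// mulr_gt0. Qed.
Let eps1 : eps <= 1.
Proof.
have D320 : 0 < 32 * D by rewrite mulr_gt0.
by rewrite /eps ler_pdivrMr//; move: p1 D10; lra.
Qed.
Let A0 : 0 < A. Proof. by rewrite divr_gt0. Qed.
Let sm0 : 0 < Num.sqrt m%:R :> R. Proof. by rewrite sqrtr_gt0. Qed.
Let sm2 : Num.sqrt m%:R ^+ 2 = m%:R :> R. Proof. by rewrite sqr_sqrtr// ltW. Qed.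
Let h0 : 0 < h. Proof. by rewrite divr_gt0. Qed.

Let NE : N%:R = N%:R / m%:R * m%:R :> R. Proof. by rewrite divfK// gt_eqF. Qed.

(** A unit vector has [l1]-norm at most [sqrt m], that is [m / eps] in units of [h]; rounding adds
    at most 1 per coordinate, and [m <= m / eps]. Hence [A = 2 / eps]. *)
Lemma rounding_in_net (y : 'I_m -> R) (k : 'I_m -> int) : dot y y = 1 ->
  (forall j, `|h * (k j)%:~R - y j| <= h) ->
  exists n : net, (forall j, pt n j = h * (k j)%:~R) /\
    (\sum_j `|(n j)%:R - B%:R| <= A * m%:R)%R.
Proof.
move=> y1 ky.
have ksum : \sum_j `|(k j)%:~R| <= A * m%:R :> R.
  have ysum : \sum_j `|y j| <= Num.sqrt m%:R.
    rewrite (_ : \sum_j _ = dot (fun j => `|y j|) (fun=> 1)); last first.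
      by apply: eq_bigr => j _; rewrite mulr1.
    rewrite -[leRHS]mul1r; apply: dot_le => //; last first.
      by rewrite sm2 /dot sumr_const card_ord mulr1.
    rewrite expr1n -[leRHS]y1 /dot.
    by apply: ler_sum => j _; rewrite -normrM ger0_norm// -expr2 sqr_ge0.
  have kj j : `|(k j)%:~R| <= h^-1 * `|y j| + 1 :> R.
    rewrite -(ler_pM2l h0) mulrDr mulrA mulfV ?gt_eqF// mul1r mulr1.
    rewrite -[X in X * _](gtr0_norm h0) -normrM.
    by rewrite -(subrK (y j) (h * _)) (le_trans (ler_normD _ _))// addrC lerD2l.
  apply: (le_trans (ler_sum _ (fun j _ => kj j))).
  rewrite big_split/= sumr_const card_ord -big_distrr/=.
  apply: (@le_trans _ _ (h^-1 * Num.sqrt m%:R + m%:R)).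
    by rewrite lerD2r ler_wpM2l// invr_ge0 ltW.
  rewrite (_ : h^-1 * _ = m%:R / eps); last first.
    by rewrite -[in RHS]sm2 /h; field; rewrite !gt_eqF.
  have : m%:R <= m%:R / eps by rewrite ler_pdivlMr// ler_piMr// ltW.
  by rewrite /A; lra.
have kB j : `|(k j)%:~R| < B%:R :> R.
  apply: le_lt_trans (truncnS_gt _); apply: le_trans ksum.
  by rewrite (bigD1 j)//= lerDl; apply: sumr_ge0.
have kB' j : (`|k j| < B)%N.
  by have := kB j; rewrite -intr_norm -abszE -pmulrn ltr_nat.
have nlt j : (absz (B%:Z + k j)%R < B + B.+1)%N by have [] := absz_shift (kB' j).
exists [ffun j => Ordinal (nlt j)].
have nE j : ([ffun j => Ordinal (nlt j)] j)%:R - B%:R = (k j)%:~R :> R.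
  rewrite ffunE /= [X in X - _ = _](_ : _ = (B%:Z + k j)%:~R).
    by rewrite intrD -pmulrn addrC addKr.
  by rewrite pmulrn; congr (_ %:~R); have [] := absz_shift (kB' j).
by split=> [j|]; rewrite /pt ?nE//; under eq_bigr do rewrite nE.
Qed.

Lemma finite_model_quotient :
  exists bad : pred {ffun 'I_N -> col},
    pexp (fun=> qc) (fun v => (bad v)%:R) <= expR (- (2 * m%:R)) /\
    forall v, ~~ bad v -> forall y z, Z z ->
      exists i, dot y z <= D * `|dot (fun j => x (v i j)) y|.
Proof.
have Z0 : Z (fun=> 0) by apply: Zunit; rewrite /dot big1 ?ler01// => j _; rewrite mulr0.
have /choice[zo /all_and2[Zzo zomax]] := fun n : net => near_maximizer (pt n) Z0 Zal.
pose hit n (u : col) := (c * s * dot (pt n) (zo n) / 2 <= \sum_j pt n j * x (u j))%R.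
(* Two ways to fail: too many overlong columns, or too few hits at some grid point. *)
pose bad1 (v : {ffun 'I_N -> col}) := (p * N%:R / 8 <= \sum_i (long (v i))%:R)%R.
pose bad2 n (v : {ffun 'I_N -> col}) := (\sum_i (hit n (v i))%:R <= p * N%:R / 4)%R.
exists (fun v => bad1 v || [exists n, in_net n && bad2 n v]); split.
  apply: (@le_trans _ _ (pexp (fun=> qc)
      (fun v => (bad1 v)%:R + \sum_n (in_net n)%:R * (bad2 n v)%:R))).
    apply: ler_pexp => [_ u|v]; first exact: qcpmf.1.
    have ge0 : 0 <= \sum_n (in_net n)%:R * (bad2 n v)%:R :> R.
      by apply: sumr_ge0 => n _; rewrite mulr_ge0.
    case: (bad1 v) => /=; first by rewrite lerDl.
    case: existsP => [[n /andP[nn bn]]|_]; rewrite /= add0r//.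
    rewrite (bigD1 n)//= nn bn mulr1 lerDl.
    by apply: sumr_ge0 => k _; rewrite mulr_ge0.
  rewrite pexpD pexp_sum.
  have e3 : 2 * expR (- (3 * m%:R)) <= expR (- (2 * m%:R)) :> R.
    rewrite (_ : - (2 * m%:R) = m%:R + - (3 * m%:R)); last by lra.
    rewrite expRD ler_wpM2r ?expR_ge0//; apply: le_trans (expR_ge1Dx _).
    by rewrite -[2]/(1 + 1) lerD2l ler1n.
  apply: le_trans e3; rewrite mulr_natl mulr2n lerD//.
    apply: (le_trans (@count_upper_tail R N col qc long qcpmf (p / 32) (p * N%:R / 8)
      column_norm_tail)).
    by rewrite ler_expR NE; move: mR0 numeric2; nra.
  apply: (@le_trans _ _ (\sum_(n : net) (\sum_j `|(n j)%:R - B%:R| <= A * m%:R)%R%:R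
      * expR (- (p * N%:R / 4)))).
    apply: ler_sum => n _; rewrite pexpZ /in_net.
    have [_|_] := boolP (\sum_j `|(n j)%:R - B%:R| <= A * m%:R)%R; last by rewrite !mul0r.
    have [n0|n0] := boolP (0 < dot (pt n) (pt n)); rewrite ?mul0r ?mul1r ?expR_ge0//=.
    apply: (le_trans (@count_lower_tail R N col qc (hit n) qcpmf p (p * N%:R / 4)
      (column_lower_tail n0 (Zzo n) (zomax n)))).
    by rewrite ler_expR; lra.
  rewrite -big_distrl/= expRN ler_pdivrMr ?expR_gt0//.
  apply: (le_trans (card_integer_l1_ball m B A0)).
  rewrite -expRD [X in _ <= expR X](_ : _ = (p * (N%:R / m%:R) / 4 - 3) * m%:R); last first.
    by rewrite [in LHS]NE; lra.
  rewrite expRM_natr lerXn2r ?nnegrE ?expR_ge0//.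
    by rewrite mulr_ge0 ?expR_ge0// addr_ge0// mulr_ge0// ltW.
  rewrite expRB ler_pdivlMr ?expR_gt0//; apply: le_trans numeric1.
  rewrite mulrAC -expRD (_ : 1 + 3 = 4); last by lra.
  rewrite ler_pM2l ?expR_gt0//.
  rewrite lerD2l /A /eps le_eqVlt; apply/orP; left; apply/eqP.
  by field; rewrite !gt_eqF.
move=> v /norP[]; rewrite -ltNge => nb1 /existsPn nb2.
suff unit_case (y z : 'I_m -> R) : Z z -> dot y y = 1 ->
    exists i, dot y z <= D * `|dot (fun j => x (v i j)) y|.
  move=> y z Zz; set r := Num.sqrt (dot y y).
  have [y0|y0] := eqVneq (dot y y) 0.
    exists (Ordinal N_gt0); rewrite [leLHS]big1 => [|j _].
      exact: mulr_ge0 (ltW D0) (normr_ge0 _).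
    by rewrite (dot_eq0 y0) mul0r.
  have r0 : 0 < r by rewrite sqrtr_gt0 lt_neqAle eq_sym y0 dot_ge0.
  have r2 : dot y y = r * r by rewrite -expr2 sqr_sqrtr// dot_ge0.
  have [|i] := unit_case (fun j => r^-1 * y j) z Zz.
    by rewrite dotZl dotC dotZl r2 mulKf ?mulVf ?gt_eqF.
  rewrite dotZl (dotC _ (fun j => r^-1 * y j)) dotZl normrM gtr0_norm ?invr_gt0//.
  by rewrite mulrCA ler_pM2l ?invr_gt0// => yi; exists i; rewrite (dotC (fun j => x (v i j))).
move=> Zz y1.
(* When [dot y z < 1], the vector [y] itself replaces [z]. This keeps [ka >= 1], so that rounding
   losses, which do not shrink with [dot y z], stay a small fraction of [ka]. *)
pose z1 := if dot y z < 1 then y else z.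
have Zz1 : Z z1 by rewrite /z1; case: ifP => // _; apply: Zunit; rewrite y1.
set ka := dot y z1.
have ka1 : 1 <= ka by rewrite /ka /z1; case: (ltP (dot y z) 1) => //; rewrite y1.
have yka : dot y z <= ka.
  by rewrite /ka /z1; case: (ltP (dot y z) 1) => //; rewrite y1 => /ltW.
apply: contrapT => /forallNP small.
have {}small i : `|dot (fun j => x (v i j)) y| < ka / D.
  rewrite ltr_pdivlMr// mulrC; apply: lt_le_trans yka.
  by rewrite ltNge; apply/negP/small.
have ka0 : 0 < ka by lra.
have t0 : 0 < ka / D by rewrite divr_gt0.
have L0 : 0 <= 32 / p * m%:R by rewrite mulr_ge0// ltW// divr_gt0.
have [i|k [ky cnt]] := random_rounding (good := fun i => ~~ long (v i))
    (X := fun i j => x (v i j)) y h0 t0 L0.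
  by rewrite /long -leNgt.
have [n [nE nA]] := rounding_in_net y1 ky.
have dist : dot (fun j => y j - pt n j) (fun j => y j - pt n j) <= eps ^+ 2.
  apply: (@le_trans _ _ (\sum_(j < m) h ^+ 2)).
    apply: ler_sum => j _; rewrite -expr2 -[leLHS]real_normK ?num_real//.
    by rewrite lerXn2r ?nnegrE ?(ltW h0)// distrC nE.
  rewrite sumr_const card_ord -[leLHS]mulr_natr -sm2 /h -exprMn divfK ?gt_eqF//.
have eal : eps * al <= 1 / 8.
  have D320 : 0 < 32 * D by rewrite mulr_gt0.
  by rewrite /eps mulrAC ler_pdivrMr//; move: D10 pal; lra.
have kan : ka - 1 / 8 <= dot (pt n) z1.
  have := @dot_le _ (fun j => y j - pt n j) z1 eps al eps0 (lt_le_trans ltr01 al1)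
    dist (Zal Zz1).
  by rewrite dotBl -/ka; lra.
have n0 : 0 < dot (pt n) (pt n).
  rewrite lt_neqAle dot_ge0 andbT; apply/negP => /eqP/esym pt0.
  suff : dot (pt n) z1 = 0 by lra.
  by rewrite /dot big1// => j _; rewrite (dot_eq0 pt0) mul0r.
have := nb2 n; rewrite /in_net nA n0 /= -ltNge; apply/negP; rewrite -leNgt.
(* All forms at [y] are supposed below [ka / D], so every column hit at the rounded point is
   overlong or has rounding error at least [ka / D]. That allows at most [p * N * (1 / 8 + 1 / 32)]
   hits, fewer than [p * N / 4]. *)
apply: (@le_trans _ _ (p * N%:R / 8 + N%:R * (h ^+ 2 * (32 / p * m%:R) / (ka / D) ^+ 2))).
  apply: le_trans (lerD (ltW nb1) cnt); rewrite -big_split/=; apply: ler_sum => i _.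
  have [|_] := boolP (hit n (v i)); last by rewrite addr_ge0.
  rewrite /hit => hi.
  case: (long (v i)) => /=; first by rewrite lerDl.
  rewrite add0r (_ : (ka / D <= _)%R = true)//.
  have zo1 := zomax n _ Zz1.
  have hi2 : c * s * ka * (7 / 32) <= \sum_j pt n j * x (v i j).
    apply: le_trans hi; rewrite -mulrA -[leRHS]mulrA -mulrA.
    by rewrite -[leRHS]mulrA ler_pM2l// ler_pM2l//; lra.
  have kaD : ka / D = c * s * ka / 10 by rewrite /D; field; rewrite !gt_eqF.
  have := small i; rewrite ltr_norml => /andP[_ sm].
  rewrite ler_normr; apply/orP; right.
  have -> : \sum_j x (v i j) * (y j - h * (k j)%:~R) =
      dot (fun j => x (v i j)) y - \sum_j pt n j * x (v i j).
    rewrite /dot -sumrB; apply: eq_bigr => j _; rewrite -nE; ring.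
  have : 0 < c * s * ka by rewrite mulr_gt0.
  by rewrite kaD in sm *; lra.
rewrite (_ : N%:R * _ = p * N%:R / (32 * ka ^+ 2)); last first.
  by rewrite /h expr_div_n sm2 /eps; field; rewrite !gt_eqF.
have pN : 0 < p * N%:R by rewrite mulr_gt0// ltr0n.
have : p * N%:R / (32 * ka ^+ 2) <= p * N%:R / 32.
  by rewrite ler_pM2l// lef_pV2 ?posrE ?mulr_gt0 ?exprn_gt0// ler_peMr// exprn_ege1.
by lra.
Qed.

End finite_model.

(** * Densities shifting the mean of a symmetric law *)

Section tilts_of_symmetric_laws.
Context {R : realType} {V : finType} (q x : V -> R) (rv : V -> V).
Hypotheses (qpmf : pmf q) (qx2 : \sum_a q a * x a ^+ 2 <= 1).
Hypotheses (rvK : involutive rv) (qrv : forall a, q (rv a) = q a).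
Hypothesis (xrv : forall a, x (rv a) = - x a).

Lemma sum_odd (g : V -> R) : (forall a, g (rv a) = - g a) -> \sum_a q a * g a = 0.
Proof.
move=> go; have : \sum_a q a * g a = - \sum_a q a * g a.
  rewrite [LHS](reindex_inj (inv_inj rvK)) -sumrN.
  by apply: eq_bigr => a _; rewrite qrv go mulrN.
by lra.
Qed.

(** The density [1 + w * sg x] has mass 1 by symmetry, mean [w * E], cost at most [1 + w ^+ 2], and
    is bounded by 2. The prescribed mean forces [w = z * c / E], and [|w| <= 1] keeps the density
    nonnegative. *)
Lemma tiltable_small (C c V0 z : R) : 1 <= C -> 2 <= V0 -> 0 < c ->
  c <= \sum_a q a * `|x a| -> `|z| <= 1 -> tiltable q x C c V0 z.
Proof.
move=> C1 V2 c0; set E := \sum_a _ => cE z1.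
have E0 : 0 < E by exact: lt_le_trans cE.
pose w := z * (c / E).
have w_z : `|w| <= `|z|.
  have ce0 : 0 <= c / E by rewrite ltW// divr_gt0.
  by rewrite normrM ler_piMr// (ger0_norm ce0) ler_pdivrMr// mul1r.
have w1 : `|w| <= 1 by exact: le_trans w_z z1.
have wz2 : w ^+ 2 <= z ^+ 2 by rewrite -[leLHS]real_normK ?num_real//
  -[leRHS]real_normK ?num_real// lerXn2r ?nnegrE.
have sgs a : - 1 <= w * Num.sg (x a) <= 1.
  by move: w1; rewrite ler_norml; case: sgrP => _; lra.
have sgsq a : Num.sg (x a) ^+ 2 <= 1 by case: sgrP => _; rewrite ?expr0n ?expr1n ?sqrrN ?expr1n.
have sg0 : \sum_a q a * Num.sg (x a) = 0 by apply: sum_odd => a; rewrite xrv sgrN.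
have x0 : \sum_a q a * x a = 0 by exact: sum_odd.
exists (fun a => 1 + w * Num.sg (x a)); split.
- by move=> a; have /andP[] := sgs a; lra.
- rewrite (_ : \sum_a _ = \sum_a q a + w * \sum_a q a * Num.sg (x a)).
    by rewrite sg0 qpmf.2 mulr0 addr0.
  by rewrite big_distrr -big_split; apply: eq_bigr => a _ /=; ring.
- apply: (@le_trans _ _ (1 + w ^+ 2)); last first.
    apply: (le_trans (expR_ge1Dx _)); rewrite ler_expR.
    by apply: (le_trans wz2); rewrite ler_peMl ?sqr_ge0.
  apply: (@le_trans _ _ (\sum_a q a + 2 * w * \sum_a q a * Num.sg (x a)
                          + w ^+ 2 * \sum_a q a)).
    rewrite !big_distrr -!big_split; apply: ler_sum => a _ /=.
    have := sgsq a; have := qpmf.1 a; have := sqr_ge0 w.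
    set g := Num.sg _ => w20 qa g1.
    have : 0 <= q a * (w ^+ 2 * (1 - g ^+ 2)) by rewrite mulr_ge0// mulr_ge0// subr_ge0.
    by lra.
  by rewrite sg0 qpmf.2; lra.
- rewrite (_ : \sum_a _ = \sum_a q a * x a + w * E).
    by rewrite x0 /w add0r; field; rewrite gt_eqF.
  rewrite big_distrr -big_split; apply: eq_bigr => a _ /=.
  by rewrite [in RHS]normrEsg; ring.
- apply: (@le_trans _ _ (\sum_a 2 * (q a * x a ^+ 2))); last by rewrite -big_distrr/=; move: qx2; lra.
  apply: ler_sum => a _; have /andP[_ s1] := sgs a.
  have : 0 <= q a * x a ^+ 2 by rewrite mulr_ge0 ?qpmf.1 ?sqr_ge0.
  by nra.
Qed.

Lemma sum_half_tail (t : R) : 0 < t ->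
  \sum_a q a * (t <= `|x a|)%R%:R = 2 * \sum_a q a * (t <= x a)%R%:R.
Proof.
move=> t0; rewrite mulr_natl mulr2n [X in _ = X + _](reindex_inj (inv_inj rvK)).
rewrite -big_split; apply: eq_bigr => a _ /=; rewrite qrv xrv -mulrDr; congr (_ * _).
by rewrite ler_normr; case: (leP t (x a)) => ta; case: (leP t (- x a)) => tb //=; lra.
Qed.

(** The density mixes 1 with conditioning on [z <= x]. The conditional mean [E / P] is at least [z],
    so some weight [th <= 1] tunes the mean to exactly [c * z]. Convexity of the square bounds the
    cost by [1 / P]; the density too is at most [1 / P], which bounds the second moment. *)
Lemma tiltable_large_pos (C c V0 z : R) : 0 < c <= 1 -> 0 < z ->
  expR (- (C * z ^+ 2)) <= \sum_a q a * (z <= x a)%R%:R ->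
  expR (C * z ^+ 2) <= V0 -> tiltable q x C c V0 z.
Proof.
move=> /andP[c0 c1] z0; set P := \sum_a _ => eP eV.
have P0 : 0 < P by apply: lt_le_trans eP; exact: expR_gt0.
have PV : P^-1 <= expR (C * z ^+ 2).
  by rewrite -[leRHS]invrK -expRN lef_pV2 ?posrE ?expR_gt0.
have P1 : P <= 1.
  rewrite -[leRHS]qpmf.2; apply: ler_sum => a _.
  by rewrite ler_piMr ?qpmf.1// lern1 leq_b1.
have PV1 : 1 <= P^-1 by rewrite invf_ge1.
set E := \sum_a q a * ((z <= x a)%R%:R * x a).
have zPE : z * P <= E.
  rewrite /P big_distrr; apply: ler_sum => a _ /=; rewrite mulrCA ler_wpM2l ?qpmf.1//.
  by case: (leP z (x a)) => za; rewrite ?mulr0 ?mul0r ?mulr1 ?mul1r.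
have E0 : 0 < E by apply: lt_le_trans zPE; rewrite mulr_gt0.
pose th := c * z * P / E.
have th0 : 0 <= th by rewrite ltW// divr_gt0// !mulr_gt0.
have th1 : th <= 1.
  rewrite ler_pdivrMr// mul1r; apply: le_trans zPE; rewrite -mulrA ler_piMl//.
  by rewrite ltW// mulr_gt0.
have x0 : \sum_a q a * x a = 0 by exact: sum_odd.
pose I a : R := (z <= x a)%R%:R.
have II a : I a ^+ 2 = I a by rewrite /I; case: (_ <= _); rewrite ?expr0n ?expr1n.
have I0 a : 0 <= I a by rewrite ler0n.
have PVP : P^-1 * P = 1 by rewrite mulVf// gt_eqF.
exists (fun a => (1 - th) + th * (P^-1 * I a)); split.
- have PV0 : 0 <= P^-1 by rewrite invr_ge0 ltW.
  move=> a; apply: addr_ge0 (mulr_ge0 th0 (mulr_ge0 PV0 (I0 a))).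
  by rewrite subr_ge0.
- rewrite (_ : \sum_a _ = (1 - th) * \sum_a q a + th * (P^-1 * P)).
    by rewrite PVP qpmf.2; ring.
  by rewrite /P !big_distrr -big_split; apply: eq_bigr => a _ /=; rewrite /I; ring.
- apply: le_trans PV.
  apply: (@le_trans _ _ ((1 - th) * \sum_a q a + th * (P^-1 * (P^-1 * P)))).
    have -> : (1 - th) * (\sum_a q a) + th * (P^-1 * (P^-1 * P)) =
        \sum_a ((1 - th) * q a + th * (P^-1 * (P^-1 * (q a * I a)))).
      by rewrite big_split/= -!big_distrr.
    apply: ler_sum => a _.
    have -> : (1 - th) * q a + th * (P^-1 * (P^-1 * (q a * I a))) =
      q a * ((1 - th) + th * (P^-1 * I a) ^+ 2) by rewrite exprMn II; ring.
    rewrite ler_wpM2l ?qpmf.1//.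
    have : 0 <= th * (1 - th) * (1 - P^-1 * I a) ^+ 2.
      by rewrite mulr_ge0 ?sqr_ge0// mulr_ge0// subr_ge0.
    by lra.
  by rewrite PVP qpmf.2; nra.
- rewrite (_ : \sum_a _ = (1 - th) * \sum_a q a * x a + th * (P^-1 * E)).
    by rewrite x0 /th; field; rewrite !gt_eqF.
  by rewrite /E !big_distrr -big_split; apply: eq_bigr => a _ /=; rewrite /I; ring.
- apply: le_trans eV; apply: le_trans PV.
  apply: (@le_trans _ _ (P^-1 * \sum_a q a * x a ^+ 2)); last first.
    by rewrite ler_piMr// invr_ge0 ltW.
  rewrite big_distrr/=; apply: ler_sum => a _; rewrite -[leLHS]mulrA [leRHS]mulrCA.
  rewrite ler_wpM2l ?qpmf.1// ler_wpM2r ?sqr_ge0//.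
  have I1 : I a <= 1 by rewrite lern1 leq_b1.
  have : th * (P^-1 * I a) <= th * P^-1 by rewrite ler_wpM2l// ler_piMr// invr_ge0 ltW.
  by nra.
Qed.

End tilts_of_symmetric_laws.

(** A negative [z] is treated by the positive case for [- x]; the factor [1 / 2] passes from the
    two-sided to the one-sided tail. *)
Lemma tiltable_large (R : realType) (V : finType) (q x : V -> R) (rv : V -> V)
    (C c V0 z : R) : pmf q -> \sum_a q a * x a ^+ 2 <= 1 -> involutive rv ->
  (forall a, q (rv a) = q a) -> (forall a, x (rv a) = - x a) ->
  0 < c <= 1 -> z != 0 ->
  expR (- (C * z ^+ 2)) <= (\sum_a q a * (`|z| <= `|x a|)%R%:R) / 2 ->
  expR (C * z ^+ 2) <= V0 -> tiltable q x C c V0 z.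
Proof.
move=> qpmf qx2 rvK qrv xrv c01 z0 tail eV.
have z0' : 0 < `|z| by rewrite normr_gt0.
have half (x' : V -> R) : (forall a, x' (rv a) = - x' a) -> (forall a, `|x' a| = `|x a|) ->
    expR (- (C * `|z| ^+ 2)) <= \sum_a q a * (`|z| <= x' a)%R%:R.
  move=> x'rv x'x; rewrite real_normK ?num_real//; apply: (le_trans tail).
  under eq_bigr do rewrite -x'x.
  by rewrite (sum_half_tail rvK qrv x'rv z0'); lra.
have eV' : expR (C * `|z| ^+ 2) <= V0 by rewrite real_normK ?num_real.
have [zp|zn] := ltP 0 z.
  rewrite -[z]gtr0_norm//; apply: (tiltable_large_pos qpmf qx2 rvK qrv xrv) => //.
  exact: half.
have [|||f [f0 f1 f2 fx fx2]] :=
    @tiltable_large_pos R V q (fun a => - x a) rv qpmf _ rvK qrv _ C c V0 `|z| c01 z0' _ eV'.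
- by under eq_bigr do rewrite sqrrN.
- by move=> a; rewrite xrv.
- by apply: half => a; rewrite ?xrv ?normrN.
exists f; split => //.
- by rewrite real_normK ?num_real in f2.
- move: fx; rewrite ler0_norm// mulrN.
  under eq_bigr do rewrite mulrN; by rewrite sumrN => /oppr_inj.
- by under eq_bigr do rewrite -[x _ ^+ 2]sqrrN.
Qed.

(** * Duality between the quotient property and lower bounds on linear forms *)

Section duality.
Context {R : realType}.

Lemma continuous_sumr (T : topologicalType) (I : finType) (F : I -> T -> R) :
  (forall i, continuous (F i)) -> continuous (fun t => \sum_i F i t).
Proof. by move=> Fc; apply: continuous_big => //; exact: add_continuous. Qed.

Lemma continuous_linear_form N (c : 'I_N -> R) :
  continuous (fun u : 'rV[R]_N => \sum_i c i * u ord0 i).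
Proof.
apply: continuous_sumr => i u.
apply: (@continuousM R _ (fun=> c i) (fun u : 'rV[R]_N => u ord0 i)).
  exact: cst_continuous.
exact: coord_continuous.
Qed.

Lemma dot_sub_scale (I : finType) (y d : I -> R) (t : R) :
  dot (fun j => y j - t * d j) (fun j => y j - t * d j) =
  dot y y - 2 * t * dot d y + t ^+ 2 * dot d d.
Proof.
by rewrite dotBl dotZl ![dot _ (fun j => _ - _)]dotC !dotBl !dotZl (dotC y d); ring.
Qed.

(* [w - M u0], for [u0] minimizing [|w - M u|] over the [l1]-ball of radius [r],
   is normal to the image of that ball, hence contradicts the hypothesis unless
   it vanishes. *)
Lemma l1_quotient_of_dual (m N : nat) (M : 'M[R]_(m, N)) (w : 'cV[R]_m) (r : R) :
  0 <= r ->
  (forall y : 'I_m -> R, exists i,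
    dot y (fun j => w j ord0) <= r * `|dot (fun j => M j i) y|) ->
  exists u : 'cV[R]_N, M *m u = w /\ l1norm u <= r.
Proof.
move=> r0 dual.
pose A := [set u : 'rV[R]_N | \sum_i `|u ord0 i| <= r].
pose res (u : 'rV[R]_N) j := w j ord0 - \sum_i M j i * u ord0 i.
pose g u := dot (res u) (res u).
have gc : continuous g.
  have resc j : continuous (fun u => res u j).
    move=> u; apply: (@continuousB R R _ (fun=> w j ord0)
      (fun u : 'rV[R]_N => \sum_i M j i * u ord0 i)).
      exact: cst_continuous.
    exact: continuous_linear_form.
  apply: continuous_sumr => j u.
  by apply: (@continuousM R _ (fun u => res u j) (fun u => res u j)); exact: resc.
have A0 : A !=set0 by exists 0; rewrite /A/= big1// => i _; rewrite mxE normr0.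
have closedA : closed A.
  rewrite (_ : A = (fun u : 'rV[R]_N => \sum_i `|u ord0 i|) @^-1` [set x | x <= r])//.
  apply: preimage_closed; last exact: closed_le.
  move=> u _; apply: continuous_sumr => i {}u.
  apply: (@continuous_comp _ _ _ (fun u : 'rV[R]_N => u ord0 i) Num.norm).
    exact: coord_continuous.
  exact: norm_continuous.
have boundA (u : 'rV[R]_N) : A u -> forall i, `|u ord0 i| <= r.
  by move=> Au i; apply: le_trans Au; rewrite (bigD1 i)//= lerDl sumr_ge0.
have compactA : compact A.
  have box := @rV_compact R N (fun=> `[- r, r]%classic) (fun=> segment_compact (a := - r) (b := r)).
  apply: subclosed_compact closedA box _ => u Au i /=.
  by rewrite in_itv/= -ler_norml boundA.
have [u0] := compact_EVT_min A0 compactA (continuous_subspaceT gc).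
rewrite inE => Au0 umin.
pose y := res u0.
have opt i (e : R) : `|e| <= r ->
    e * dot (fun j => M j i) y <= dot y (fun j => \sum_k M j k * u0 ord0 k).
  (* Segment from [u0] to [e] times the [i]-th unit vector, which stays in the ball; along it the
     residual is [y - t * d]. *)
  move=> er; pose d j := M j i * e - \sum_k M j k * u0 ord0 k.
  have step t : 0 <= t <= 1 -> dot y y <= dot (fun j => y j - t * d j) (fun j => y j - t * d j).
    move=> /andP[t0 t1].
    pose u : 'rV[R]_N := \row_k ((1 - t) * u0 ord0 k + t * (if k == i then e else 0)).
    have Au : A u.
      apply: (@le_trans _ _ (\sum_k ((1 - t) * `|u0 ord0 k| + t * (if k == i then `|e| else 0)))).
        apply: ler_sum => k _; rewrite mxE (le_trans (ler_normD _ _))//.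
        rewrite !normrM (ger0_norm t0) ger0_norm ?subr_ge0//.
        by case: ifP; rewrite ?normr0.
      rewrite big_split/= -!big_distrr/= -big_mkcond/= big_pred1_eq.
      have : (1 - t) * \sum_k `|u0 ord0 k| <= (1 - t) * r by rewrite ler_wpM2l// subr_ge0.
      have : t * `|e| <= t * r by rewrite ler_wpM2l.
      by lra.
    have := umin u; rewrite inE => /(_ Au); rewrite /g.
    suff resE : res u = fun j => y j - t * d j by rewrite resE.
    apply/funext => j; rewrite /y /res /d.
    have -> : \sum_k M j k * u ord0 k =
        (1 - t) * \sum_k M j k * u0 ord0 k + t * (M j i * e).
      under eq_bigr do rewrite mxE mulrDr.
      rewrite big_split/= big_distrr/=; congr (_ + _).
        by apply: eq_bigr => k _; ring.
      rewrite (bigD1 i)//= eqxx big1 ?addr0; first by ring.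
      by move=> k /negPf ->; rewrite !mulr0.
    by ring.
  have dy : dot d y <= 0.
    rewrite leNgt; apply/negP => dy0.
    have dd := dot_ge0 d.
    (* This step length would change the squared residual by at most [- t * dot d y < 0], against
       minimality. *)
    pose t := dot d y / (dot d y + dot d d).
    have den : 0 < dot d y + dot d d by rewrite ltr_wpDr.
    have t01 : 0 <= t <= 1.
      apply/andP; split; first by rewrite ltW// divr_gt0.
      by rewrite ler_pdivrMr// mul1r lerDl.
    have tE : t * (dot d y + dot d d) = dot d y by rewrite divfK// gt_eqF.
    have tp : 0 < t by rewrite divr_gt0.
    have := step _ t01; rewrite dot_sub_scale.
    have : t * dot d d <= dot d y by nra.
    move=> tdd; have : t * (t * dot d d) <= t * dot d y by rewrite ler_pM2l.
    have : 0 < t * dot d y by rewrite mulr_gt0.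
    by rewrite expr2 -mulrA; lra.
  move: dy; rewrite dotBl (dotC (fun j => \sum_k _)) subr_le0.
  rewrite (_ : dot (fun j => M j i * e) y = e * dot (fun j => M j i) y)//.
  by rewrite -dotZl; apply: eq_bigr => j _; rewrite (mulrC e).
have [i wi] := dual y.
have yu0 : r * `|dot (fun j => M j i) y| <= dot y (fun j => \sum_k M j k * u0 ord0 k).
  have [dp|dn] := leP 0 (dot (fun j => M j i) y); first by rewrite ger0_norm// opt// ger0_norm.
  by rewrite ltr0_norm// mulrN -mulNr opt// normrN ger0_norm.
have y0 : dot y y = 0.
  apply/eqP; rewrite eq_le dot_ge0 andbT {2}/y /res dotC dotBl.
  by rewrite dotC [X in _ - X]dotC subr_le0 (le_trans wi).
exists u0^T; split.
  apply/matrixP => j k; rewrite ord1 mxE.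
  under eq_bigr do rewrite mxE.
  by apply/esym/eqP; rewrite -subr_eq0; apply/eqP; exact: (dot_eq0 y0).
by rewrite /l1norm; under eq_bigr do rewrite mxE.
Qed.

End duality.

(** * Quantization of the real line *)

Section quantization.
Context {R : realType}.
Variables (n : nat) (d : R).

(** Rounding is towards zero and saturates at [n]: absolute values never increase, so second moment
    bounds survive. *)
Definition level (x : R) : nat := minn n (Num.truncn (`|x| / d)).

(** The sign is laid out around the centre [n], so that negation becomes the involution
    [rev_ord]. *)
Definition quant_index (x : R) : nat := if 0 <= x then (n + level x)%N else (n - level x)%N.

Lemma level_le x : (level x <= n)%N. Proof. exact: geq_minl. Qed.

Lemma quant_index_lt x : (quant_index x < n + n.+1)%N.
Proof. by rewrite /quant_index; have := level_le x; case: ifP => _; lia. Qed.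

Definition quant (x : R) : 'I_(n + n.+1) := Ordinal (quant_index_lt x).

Definition qval (v : 'I_(n + n.+1)) : R := d * (v%:R - n%:R).

Lemma levelN x : level (- x) = level x. Proof. by rewrite /level normrN. Qed.

Lemma level0 : level 0 = 0%N.
Proof. by rewrite /level normr0 mul0r truncn0 minn0. Qed.

Lemma quantN x : quant (- x) = rev_ord (quant x).
Proof.
apply: val_inj; rewrite /= /quant_index levelN oppr_ge0; have := level_le x.
by case: (ltgtP 0 x) => [_|_|<-]; rewrite ?level0; lia.
Qed.

Lemma qval_rev v : qval (rev_ord v) = - qval v.
Proof.
rewrite /qval /= natrB ?ltn_ord// natrD -!natr1; ring.
Qed.

Lemma qval_quant x : qval (quant x) = (if 0 <= x then d * (level x)%:R else - (d * (level x)%:R)).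
Proof.
by rewrite /qval /= /quant_index; case: ifP => _; rewrite ?natrD ?natrB ?level_le//; ring.
Qed.

Hypothesis d0 : 0 < d.

Lemma norm_qval_quant x : `|qval (quant x)| = d * (level x)%:R.
Proof.
by rewrite qval_quant; case: ifP => _; rewrite ?normrN ger0_norm// mulr_ge0// ltW.
Qed.

Lemma norm_div_ge0 (x : R) : 0 <= `|x| / d. Proof. by rewrite divr_ge0// ltW. Qed.

Lemma level_itv x : `|x| <= n%:R * d ->
  d * (level x)%:R <= `|x| <= d * (level x)%:R + d.
Proof.
move=> xn.
have xdn : (Num.truncn (`|x| / d) <= n)%N.
  rewrite -(ler_nat R); apply: (@le_trans _ _ (`|x| / d)).
    by rewrite truncn_le norm_div_ge0.
  by rewrite ler_pdivrMr.
rewrite /level (minn_idPr xdn); have /andP[h1 h2] := truncn_itv (norm_div_ge0 x).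
move: h1 h2; rewrite ler_pdivlMr// ltr_pdivrMr// -natr1 => h1 h2.
by apply/andP; split; lra.
Qed.

Lemma norm_qval_le x : `|qval (quant x)| <= `|x|.
Proof.
rewrite norm_qval_quant; have [xn|xn] := leP `|x| (n%:R * d).
  by have /andP[] := level_itv xn.
apply: le_trans (ltW xn); rewrite mulrC ler_pM2r// ler_nat; exact: level_le.
Qed.

Lemma quant_err x : `|x| <= n%:R * d -> `|x - qval (quant x)| <= d.
Proof.
move=> /level_itv/andP[]; rewrite qval_quant; case: (leP 0 x) => x0.
  by rewrite ger0_norm// => h1 h2; rewrite ler_norml; lra.
by rewrite ltr0_norm// => h1 h2; rewrite ler_norml; lra.
Qed.

Lemma quant_tail (t x : R) : t <= n%:R * d -> t + d < `|x| -> t <= `|qval (quant x)|.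
Proof.
move=> tn tx; rewrite norm_qval_quant; have [xn|xn] := leP `|x| (n%:R * d).
  by have /andP[] := level_itv xn; lra.
rewrite /level (minn_idPl _); first by rewrite mulrC.
by rewrite truncn_ge_nat ?norm_div_ge0// ler_pdivlMr// ltW.
Qed.

Lemma level_homo (x y : R) : `|x| <= `|y| -> (level x <= level y)%N.
Proof.
move=> xy; rewrite leq_min geq_minl /=; apply: leq_trans (geq_minr _ _) _.
by apply: le_truncn; rewrite ler_pM2r// invr_gt0.
Qed.

(** Monotonicity makes the fibres of [quant] intervals, hence measurable. *)
Lemma quant_index_homo (x y : R) : x <= y -> (quant_index x <= quant_index y)%N.
Proof.
move=> xy; rewrite /quant_index; case: (leP 0 x) => x0; case: (leP 0 y) => y0.
- by rewrite leq_add2l level_homo// !ger0_norm.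
- by have := lt_le_trans y0 (le_trans x0 xy); rewrite ltxx.
- by lia.
- by rewrite leq_sub2l// level_homo// !ltr0_norm// lerN2.
Qed.

Lemma measurable_quant v : measurable (quant @^-1` [set v]).
Proof.
apply: is_interval_measurable => x y qx qy z /andP[xz zy]; apply: val_inj => /=.
apply/eqP; rewrite eqn_leq; move: qx qy => /= /(congr1 val)/= qx /(congr1 val)/= qy.
by rewrite -{1}qy -qx !quant_index_homo.
Qed.

End quantization.

(** * Laws of finitely valued random variables *)

Section laws_of_finite_valued_variables.
Context {R : realType} {d : measure_display} {T : measurableType d}.
Variables (P : probability T R) (V : finType) (Y : T -> V).
Hypothesis mY : forall v, measurable (Y @^-1` [set v]).

Definition law (v : V) : R := fine (P (Y @^-1` [set v])).

Lemma law_ge0 v : 0 <= law v. Proof. exact: fine_ge0. Qed.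

Lemma lawE v : P (Y @^-1` [set v]) = (law v)%:E.
Proof. by rewrite fineK// fin_num_measure. Qed.

Lemma measurable_finite_valued (S : pred V) : measurable [set w | S (Y w)].
Proof.
rewrite (_ : [set w | S (Y w)] = \bigcup_(v in [set v | S v]) Y @^-1` [set v]).
  by apply: fin_bigcup_measurable => //; exact: finite_finset.
by apply/seteqP; split=> [w Sw|w [v Sv /= ->]] //; exists (Y w).
Qed.

Lemma prob_finite_valued (S : pred V) :
  P [set w | S (Y w)] = (\sum_v law v * (S v)%:R)%:E.
Proof.
have Pseq (s : seq V) : uniq s ->
    P [set w | Y w \in s] = (\sum_(v <- s) law v)%:E.
  elim: s => [_|v s IH /=/andP[vs us]].
    rewrite big_nil (_ : [set w | _] = set0) ?measure0//.
    by apply/seteqP; split.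
  rewrite (_ : [set w | Y w \in v :: s] = Y @^-1` [set v] `|` [set w | Y w \in s]).
    rewrite measureU//; last 2 first.
    - exact: (measurable_finite_valued (fun v => v \in s)).
    - apply/seteqP; split=> // w [/= Yv Ys].
      by move: vs; rewrite -Yv Ys.
    by rewrite big_cons EFinD -IH//; congr (_ + _)%E; exact: lawE.
  apply/seteqP; split=> w /=; rewrite inE.
    by case/orP => [/eqP ->|]; [left|right].
  by case=> [->|->]; rewrite ?eqxx ?orbT.
rewrite (_ : [set w | S (Y w)] = [set w | Y w \in [seq v <- index_enum V | S v]]).
  rewrite Pseq ?filter_uniq ?index_enum_uniq// big_filter big_mkcond/=; congr (_%:E).
  by apply: eq_bigr => v _; case: (S v); rewrite ?mulr1 ?mulr0.
by apply/seteqP; split=> w /=; rewrite mem_filter mem_index_enum andbT.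
Qed.

Lemma law_pmf : pmf law.
Proof.
split=> [v|]; first exact: law_ge0.
have := prob_finite_valued predT.
rewrite (_ : [set w | _] = setT) ?probability_setT; last by apply/seteqP; split.
move=> /(congr1 fine)/= e; rewrite [RHS]e.
by apply: eq_bigr => v _; rewrite mulr1.
Qed.

(** Carries moment bounds from integrals to finite sums: [g (Y w)] is a combination of indicators of
    fibres. *)
Lemma law_le_integral (g : V -> R) (f : T -> R) : (forall v, 0 <= g v) ->
  measurable_fun setT f -> (forall w, g (Y w) <= f w) ->
  ((\sum_v law v * g v)%:E <= \int[P]_w (f w)%:E)%E.
Proof.
move=> g0 mf gf.
have -> : (\sum_v law v * g v)%:E =
    (\int[P]_w \sum_(v <- index_enum V) (g v * \1_(Y @^-1` [set v]) w)%:E)%E.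
  rewrite ge0_integral_sum//; last 2 first.
  - move=> v; apply/measurable_EFinP; apply: measurable_funM.
      exact: measurable_cst.
    exact: measurable_indic.
  - by move=> v w _; rewrite lee_fin mulr_ge0.
  rewrite -sumEFin; apply: eq_bigr => v _.
  under eq_integral do rewrite EFinM.
  rewrite ge0_integralZl_EFin//; last by apply/measurable_EFinP; exact: measurable_indic.
  by rewrite integral_indic// setIT mulrC EFinM -lawE.
apply: ge0_le_integral => //.
- by move=> w _; apply: sume_ge0 => v _; rewrite lee_fin mulr_ge0.
- apply: emeasurable_sum => v; apply/measurable_EFinP; apply: measurable_funM.
    exact: measurable_cst.
  exact: measurable_indic.
- exact/measurable_EFinP.
move=> w _; rewrite sumEFin lee_fin (bigD1 (Y w))//= big1 ?addr0.
  by rewrite indicE mem_set ?mulr1.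
move=> v vY; rewrite indicE memNset ?mulr0// => /= Yv.
by rewrite Yv eqxx in vY.
Qed.

End laws_of_finite_valued_variables.

(** * Tail bounds from moments and for the Gaussian *)

Section tails.
Context {R : realType} {d : measure_display} {T : measurableType d}.
Variables (P : probability T R) (X : {RV P >-> R}).
Hypothesis X2 : ('E_P[fun w => (X w ^+ 2)%R] = 1)%E.

Lemma measurable_norm_gt (t : R) : measurable [set w | (t < `|X w|)%R].
Proof.
rewrite -[X in measurable X]setTI; apply: (@measurable_fun_ltr _ _ R setT (cst t) (fun w => `|X w|)) => //.
exact: measurableT_comp.
Qed.

Lemma measurable_norm_gt_bool (t : R) (b : bool) :
  measurable ((fun w => t < `|X w|) @^-1` [set b]).
Proof.
case: b; first by rewrite (_ : _ @^-1` _ = [set w | (t < `|X w|)%R])//; exact: measurable_norm_gt.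
rewrite (_ : _ @^-1` _ = ~` [set w | (t < `|X w|)%R]).
  by apply: measurableC; exact: measurable_norm_gt.
by apply/seteqP; split=> w /=; [move=> ->|move/negP/negbTE].
Qed.

Lemma second_moment_tail (t : R) : 0 < t ->
  (P [set w | (t < `|X w|)%R] <= (t ^- 2)%:E)%E.
Proof.
move=> t0.
pose Y w := (t < `|X w|).
have mX2 : measurable_fun setT (fun w => X w ^+ 2).
  exact: measurable_funX.
have mY := measurable_norm_gt_bool t.
have H : ((\sum_b law P Y b * (t ^+ 2 * b%:R))%:E <= 1)%E.
  have <- : (\int[P]_w (X w ^+ 2)%:E)%E = 1%E by rewrite -X2 unlock.
  apply: law_le_integral => //.
    by move=> b; rewrite mulr_ge0 ?sqr_ge0.
  move=> w; rewrite /Y; have [tw|_] := boolP (t < `|X w|); last by rewrite mulr0 sqr_ge0.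
  by rewrite mulr1 -[leRHS]real_normK ?num_real// lerXn2r ?nnegrE// ltW.
rewrite (prob_finite_valued P mY id) lee_fin -[leRHS]mul1r ler_pdivlMr ?exprn_gt0//.
rewrite lee_fin in H; apply: le_trans H.
rewrite big_distrl/= le_eqVlt; apply/orP; left; apply/eqP.
by apply: eq_bigr => b _; ring.
Qed.

(** Pointwise [x^2 <= 1/4 + A 1_{|x| > 1/2} + x^4 / A], by comparing [x^2] with [A]. For
    [A = 4 K^4 + 1] the last term has mean at most [1 / 4], which leaves the event a mass of
    [1 / (2 A)]. *)
Lemma fourth_moment_tail (K : R) :
  (Lnorm P 4%:E (EFin \o X) <= K%:E)%E ->
  ((1 / (2 * (4 * K ^+ 4 + 1)))%:E <= P [set w | (1 / 2 < `|X w|)%R])%E.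
Proof.
move=> XK.
have X4 : (\int[P]_w (X w ^+ 4)%:E <= (K ^+ 4)%:E)%E.
  have K0 : 0 <= K by rewrite -lee_fin (le_trans _ XK)// Lnorm_ge0.
  rewrite (_ : \int[P]_w _ = Lnorm P 4%:E (EFin \o X) `^ 4)%E; last first.
    rewrite poweR_Lnorm//; apply: eq_integral => w _ /=.
    by rewrite (powR_mulrn 4)// -normrX ger0_norm// exprn_even_ge0.
  have : (Lnorm P 4%:E (EFin \o X) \is a fin_num)%E.
    by rewrite ge0_fin_numE ?Lnorm_ge0// (le_lt_trans XK) ?ltry.
  move: XK; have := Lnorm_ge0 P 4%:E (EFin \o X).
  case: (Lnorm _ _ _) => //= r; rewrite !lee_fin => r0 rK _.
  by rewrite (powR_mulrn 4)// lerXn2r ?nnegrE.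
pose A := 4 * K ^+ 4 + 1.
have A0 : 0 < A by rewrite ltr_wpDl// mulr_ge0// exprn_even_ge0.
pose E := [set w | (1 / 2 < `|X w|)%R].
have mE : measurable E by exact: measurable_norm_gt.
have mX4 : measurable_fun setT (fun w => A^-1 * X w ^+ 4).
  by apply: measurable_funM; [exact: measurable_cst|exact: measurable_funX].
have mI : measurable_fun setT (fun w => A * \1_E w).
  by apply: measurable_funM; [exact: measurable_cst|exact: measurable_indic].
have X4_ge0 w : 0 <= A^-1 * X w ^+ 4.
  by rewrite mulr_ge0 ?invr_ge0 ?exprn_even_ge0// ltW.
have I_ge0 w : 0 <= A * \1_E w by rewrite mulr_ge0// ltW.
have : (1 <= (1 / 4)%:E + (A%:E * P E + (A^-1)%:E * \int[P]_w (X w ^+ 4)%:E))%E.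
  have <- : (\int[P]_w (X w ^+ 2)%:E)%E = 1%E by rewrite -X2 unlock.
  have -> : ((1 / 4)%:E + (A%:E * P E + (A^-1)%:E * \int[P]_w (X w ^+ 4)%:E))%E =
      (\int[P]_w ((1 / 4)%:E + ((A * \1_E w)%:E + (A^-1 * X w ^+ 4)%:E)))%E.
    rewrite ge0_integralD//; last 2 first.
    - by move=> w _; rewrite -EFinD lee_fin addr_ge0.
    - by apply: emeasurable_funD; exact/measurable_EFinP.
    rewrite integral_cst//= probability_setT mule1; congr (_ + _)%E.
    rewrite ge0_integralD//; try exact/measurable_EFinP; try by move=> w _; rewrite lee_fin.
    congr (_ + _)%E.
      under eq_integral do rewrite EFinM.
      rewrite ge0_integralZl_EFin ?ltW//; last by apply/measurable_EFinP; exact: measurable_indic.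
      by rewrite integral_indic// setIT.
    under eq_integral do rewrite EFinM.
    rewrite ge0_integralZl_EFin ?invr_ge0 ?(ltW A0)//.
      by move=> w _; rewrite lee_fin exprn_even_ge0.
    by apply/measurable_EFinP; exact: measurable_funX.
  apply: ge0_le_integral => //.
  - by move=> w _; rewrite lee_fin sqr_ge0.
  - by apply/measurable_EFinP; exact: measurable_funX.
  - apply: emeasurable_funD => //.
    by apply: emeasurable_funD; exact/measurable_EFinP.
  move=> w _; rewrite -!EFinD lee_fin.
  have [AX|XA] := leP A (X w ^+ 2).
    have : X w ^+ 2 <= A^-1 * X w ^+ 4.
      rewrite mulrC ler_pdivlMr// (_ : 4%N = (2 + 2)%N)// exprD.
      by rewrite ler_wpM2l ?sqr_ge0.
    by have := I_ge0 w; lra.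
  have := X4_ge0 w; rewrite indicE; have [Ew|nEw] := boolP (w \in E).
    by rewrite mulr1; lra.
  move: nEw; rewrite notin_setE => /negP; rewrite -leNgt => Xw.
  have : `|X w| ^+ 2 <= (1 / 2) ^+ 2 by rewrite lerXn2r ?nnegrE//; lra.
  by rewrite real_normK ?num_real// mulr0; lra.
have PEf : P E \is a fin_num by rewrite fin_num_measure.
rewrite -(fineK PEf) => H.
have : (1 <= (1 / 4 + (A * fine (P E) + 1 / 4))%:E)%E.
  apply: (le_trans H); rewrite !EFinD leeD2l// EFinM leeD2l//.
  apply: (@le_trans _ _ ((A^-1)%:E * (K ^+ 4)%:E)%E).
    by rewrite lee_pmul2l// lte_fin invr_gt0.
  by rewrite -EFinM lee_fin mulrC ler_pdivrMr// /A; lra.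
rewrite !lee_fin ler_pdivrMr ?mulr_gt0//.
by rewrite -/A; lra.
Qed.

End tails.

Lemma measurable_scaled_norm_gt (R : realType) (sigma t : R) : 0 < sigma ->
  measurable [set x : R | (t < `|sigma * x|)%R].
Proof.
move=> s0; rewrite -[X in measurable X]setCK; apply: measurableC.
have CE (x : R) : (~` [set x : R | t < `|sigma * x|]) x <-> `|sigma * x| <= t.
  by rewrite leNgt; split=> [/negP|/negP].
apply: is_interval_measurable => x y tx ty z /andP[xz zy].
move: tx ty => /(CE x).1 + /(CE y).1; rewrite !ler_norml => tx ty.
by apply: (CE z).2; rewrite ler_norml; nra.
Qed.

(** The unit interval to the right of [u = t / sigma] suffices: there the exponent is at most
    [(u + 1)^2 / 2 <= 1 + u^2]. *)
Lemma normal_tail (R : realType) (sigma t : R) : 0 < sigma -> 0 < t ->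
  ((normal_peak 1 * expR (- (1 + (t / sigma) ^+ 2)))%:E <=
    normal_prob 0 1 [set x : R | (t < `|sigma * x|)%R])%E.
Proof.
move=> s0 t0; set u := t / sigma.
have u0 : 0 < u by rewrite divr_gt0.
pose I : set R := `]u, (u + 1)]%classic.
rewrite /normal_prob.
apply: (@le_trans _ _ (\int[lebesgue_measure]_(x in I) (normal_pdf 0 1 x)%:E)%E); last first.
  apply: ge0_subset_integral => //.
  - exact: measurable_itv.
  - exact: measurable_scaled_norm_gt.
  - by apply/measurable_EFinP; apply: measurable_funTS; exact: measurable_normal_pdf.
  - by move=> x _; rewrite lee_fin normal_pdf_ge0.
  - move=> x; rewrite /I /= in_itv/= => /andP[ux _].
    by rewrite normrM gtr0_norm// gtr0_norm ?(lt_trans u0)// mulrC -ltr_pdivrMr.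
apply: (@le_trans _ _ (\int[lebesgue_measure]_(x in I)
    (cst (normal_peak 1 * expR (- (1 + u ^+ 2)))%:E) x)%E).
  rewrite integral_cst; last exact: measurable_itv.
  have I1 : lebesgue_measure I = 1%E.
    rewrite /I lebesgue_measure_itv/= lte_fin ltrDl ltr01.
    by rewrite -EFinD addrC addKr.
  by rewrite [X in (_ <= _ * X)%E]I1 mule1.
apply: ge0_le_integral => //.
- exact: measurable_itv.
- by move=> x _; rewrite lee_fin mulr_ge0 ?normal_peak_ge0 ?expR_ge0.
- by apply/measurable_EFinP; apply: measurable_funTS; exact: measurable_normal_pdf.
move=> x; rewrite /I /= in_itv/= => /andP[ux xu].
rewrite lee_fin normal_pdfE ?oner_eq0// ler_wpM2l ?normal_peak_ge0// ler_expR.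
rewrite subr0 expr1n mulNr lerN2.
have sq (y : R) : u < y -> y <= u + 1 -> y ^+ 2 / 2 <= 1 + u ^+ 2.
  move=> uy yu; have : 0 <= (u + 1 - y) * (u + 1 + y) by rewrite mulr_ge0//; lra.
  by have := sqr_ge0 (u - 1); lra.
exact: sq.
Qed.

(** * Choice of the constants *)

Section constants.
Context {R : realType}.
Variables (C c : R).
Hypotheses (C1 : 1 <= C) (c01 : 0 < c <= 1).

(** With [E = exp (C s^2 al^2)] and [V0 = 2 E], the admissible [p] has order [E^(-3)]; for
    [s = 1 / (6 C)] one gets [E^3 = exp (s al^2 / 2)], at most [sqrt (e N / m)]. *)
Definition scale : R := (6 * C)^-1.
Definition quotient_const : R := 10 / (c * scale).
(** This will be [p * sqrt (e N / m)]; the 8 is the 2 of [V0] times the 4 of [K]. *)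
Definition peak_const : R := (4 * (1 + 8 / (c * scale) ^+ 2)) ^- 2.

Let C0 : 0 < C. Proof. exact: lt_le_trans C1. Qed.
Let c0 : 0 < c. Proof. by case/andP: c01. Qed.
Lemma scale_gt0 : 0 < scale. Proof. by rewrite invr_gt0 mulr_gt0. Qed.
Lemma scale_le1 : scale <= 1.
Proof. by rewrite invf_le1 ?mulr_gt0//; move: C1; lra. Qed.
Lemma cscale_gt0 : 0 < c * scale. Proof. by rewrite mulr_gt0 ?scale_gt0. Qed.
Lemma quotient_const_gt0 : 0 < quotient_const.
Proof. by rewrite divr_gt0 ?cscale_gt0. Qed.

Let k_den : 1 <= 4 * (1 + 8 / (c * scale) ^+ 2).
Proof.
have : 0 <= 8 / (c * scale) ^+ 2 by rewrite divr_ge0 ?sqr_ge0.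
by lra.
Qed.

Lemma peak_const_gt0 : 0 < peak_const.
Proof. by rewrite invr_gt0 exprn_gt0// (lt_le_trans ltr01). Qed.
Lemma peak_const_le1 : peak_const <= 1.
Proof. by rewrite invf_le1 ?exprn_gt0 ?(lt_le_trans ltr01)// exprn_ege1. Qed.

(** For [g = sqrt (e * rho)] and [p = k / g], one has [p * rho = k * g / e] and [1 / p = g / k]: an
    exponential in [g] against a linear function. All conditions hold once [g >= G], which
    [rho >= G ^+ 2] ensures. *)
Lemma probability_level : exists Ct : R, 1 <= Ct /\ forall rho, Ct <= rho ->
  let al := Num.sqrt (ln (expR 1 * rho)) in
  let V0 := 2 * expR (C * (scale ^+ 2 * al ^+ 2)) in
  1 <= al /\ exists p,
    [/\ 0 < p, p * al <= 1,
      p <= (4 * (1 + V0 * (4 / (c * scale) ^+ 2))) ^- 2 *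
             expR (- (C * (scale ^+ 2 * al ^+ 2))),
      expR 4 * (1 + 128 * quotient_const / p) <= expR (p * rho / 4) &
      96 <= p * rho].
Proof.
pose e : R := expR 1.
have e0 : 0 < e by exact: expR_gt0.
have e1 : 1 <= e by rewrite -[leLHS]expR0 ler_expR.
set k := peak_const; have k0 : 0 < k := peak_const_gt0.
set Q := quotient_const; have Q0 : 0 < Q := quotient_const_gt0.
(* Comes from [exp X >= X ^+ 2 / 2] at [X = k * g / (4 * e)]; the term [96 * e / k] of [G] comes
   from [96 <= p * rho]. *)
pose G2 := 32 * e ^+ 2 * (expR 4 * (1 + 128 * Q / k)) / k ^+ 2.
have QK0 : 0 < expR 4 * (1 + 128 * Q / k).
  by rewrite mulr_gt0 ?expR_gt0// addr_gt0// divr_gt0// mulr_gt0.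
have G20 : 0 < G2.
  by rewrite divr_gt0 ?exprn_gt0// mulr_gt0// mulr_gt0// exprn_gt0.
pose G := 1 + 96 * e / k + G2.
have Gk0 : 0 < 96 * e / k by rewrite divr_gt0// mulr_gt0.
have G1 : 1 <= G by rewrite /G; lra.
exists (G ^+ 2); split; first exact: exprn_ege1.
move=> rho Grho al V0.
have rho1 : 1 <= rho by apply: le_trans Grho; exact: exprn_ege1.
have rho0 : 0 < rho by exact: lt_le_trans rho1.
have erho : 0 < e * rho by rewrite mulr_gt0.
have lnE : ln (e * rho) = 1 + ln rho by rewrite lnM ?posrE// expRK.
have ln1 : 1 <= ln (e * rho) by rewrite lnE lerDl ln_ge0.
have al2 : al ^+ 2 = ln (e * rho) by rewrite sqr_sqrtr// (le_trans ler01).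
have al1 : 1 <= al by rewrite -[leLHS]sqrtr1 ler_wsqrtr.
split=> //.
pose g := expR (al ^+ 2 / 2).
have g0 : 0 < g by exact: expR_gt0.
have g2 : g ^+ 2 = e * rho.
  by rewrite expr2 -expRD -splitr al2 lnK// posrE.
have gG : G <= g.
  rewrite -(@ler_pXn2r _ 2)// ?nnegrE ?(ltW g0) ?(le_trans ler01 G1)//.
  by rewrite g2 (le_trans Grho)// ler_peMl// ltW.
have g1 : 1 <= g by exact: le_trans gG.
exists (k / g).
have prho : k / g * rho = k * g / e.
  have -> : rho = g ^+ 2 / e by rewrite g2 mulrC mulKf// gt_eqF.
  by field; rewrite !gt_eqF.
split.
- by rewrite divr_gt0.
- rewrite mulrAC ler_pdivrMr// mul1r.
  apply: (@le_trans _ _ al); first by rewrite ler_piMl ?peak_const_le1// (le_trans ler01).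
  apply: le_trans (expR_ge1Dx _).
  by have := sqr_ge0 (al - 1); rewrite sqrrB; lra.
- rewrite /V0; set E := expR (C * _).
  have E1 : 1 <= E.
    by rewrite -[leLHS]expR0 ler_expR; apply: mulr_ge0; [exact: ltW|rewrite -exprMn sqr_ge0].
  have E0 : 0 < E by exact: expR_gt0.
  have Eg : E ^+ 3 <= g.
    rewrite /E -expRM_natl ler_expR.
    have sC : scale * C = 6^-1 by rewrite /scale invfM -mulrA mulVf ?mulr1// gt_eqF.
    have := scale_le1; have := scale_gt0; have := sqr_ge0 al.
    move: sC; set s := scale; set a2 := al ^+ 2 => sC a20 s0 s1.
    have -> : 3 * (C * (s ^+ 2 * a2)) = s * (a2 / 2).
      by transitivity ((s * C) * (3 * s * a2)); [ring|rewrite sC; field].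
    by rewrite ler_piMl// divr_ge0.
  rewrite expRN -/E.
  set q := 8 / (c * scale) ^+ 2.
  have q0 : 0 <= q by rewrite divr_ge0 ?sqr_ge0.
  have -> : 2 * E * (4 / (c * scale) ^+ 2) = E * q by rewrite /q; ring.
  apply: (@le_trans _ _ ((4 * (1 + q) * E) ^- 2 / E)); last first.
    rewrite ler_pM2r ?invr_gt0// lef_pV2 ?posrE ?exprn_gt0 ?mulr_gt0//; try by nra.
    by rewrite lerXn2r ?nnegrE; nra.
  rewrite [leRHS](_ : _ = k / E ^+ 3).
    by rewrite ler_pM2l// lef_pV2 ?posrE ?exprn_gt0.
  have q1 : 1 + q != 0 by rewrite gt_eqF// ltr_pwDl.
  by rewrite /k /peak_const -/q; field; rewrite q1 gt_eqF.
- rewrite prho; set X := k * g / e / 4.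
  have X0 : 0 <= X by rewrite ltW// !divr_gt0// mulr_gt0.
  apply: le_trans (expR_ge1Dxn 1 X0).
  apply: (@le_trans _ _ (X ^+ 2 / 2)); last by rewrite [2`!]/= lerDr.
  apply: (@le_trans _ _ (expR 4 * (1 + 128 * Q / k) * g)).
    rewrite -[leRHS]mulrA ler_pM2l ?expR_gt0//.
    have -> : 128 * Q / (k / g) = 128 * Q / k * g by field; rewrite !gt_eqF.
    by lra.
  have -> : expR 4 * (1 + 128 * Q / k) = G2 * k ^+ 2 / (32 * e ^+ 2).
    by rewrite /G2; field; rewrite !gt_eqF.
  have -> : X ^+ 2 / 2 = g * k ^+ 2 / (32 * e ^+ 2) * g by rewrite /X; field; rewrite !gt_eqF.
  rewrite ler_pM2r// ler_pM2r ?invr_gt0 ?mulr_gt0 ?exprn_gt0// ler_pM2r ?exprn_gt0//.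
  by apply: le_trans gG; rewrite /G; lra.
- rewrite prho ler_pdivlMr// -ler_pdivrMl// mulrC; apply: le_trans gG.
  by rewrite /G; lra.
Qed.

End constants.

(** * The quantized law of an entry *)

Section discretized_law.
Context {R : realType} {d : measure_display} {T : measurableType d}.
Variables (P : probability T R) (X : {RV P >-> R}).
Hypothesis X2 : ('E_P[fun w => (X w ^+ 2)%R] = 1)%E.
Hypothesis Xsym : symmetric_rv P X.
Variables (n : nat) (e : R).
Hypothesis e0 : 0 < e.

Definition disc_law := law P (quant n e \o X).

Lemma measurable_quant_rv v : measurable ((quant n e \o X) @^-1` [set v]).
Proof.
rewrite comp_preimage; exact: measurable_funPTI (measurable_quant e0 v).
Qed.

Lemma disc_law_pmf : pmf disc_law.
Proof. by apply: law_pmf; exact: measurable_quant_rv. Qed.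

Lemma disc_law_second_moment : \sum_v disc_law v * qval e v ^+ 2 <= 1.
Proof.
rewrite -lee_fin.
have <- : (\int[P]_w (X w ^+ 2)%:E)%E = 1%E by rewrite -X2 unlock.
apply: law_le_integral.
- exact: measurable_quant_rv.
- by move=> v; exact: sqr_ge0.
- exact: measurable_funX.
- move=> w; rewrite -[leLHS]real_normK ?num_real// -[leRHS]real_normK ?num_real//.
  by rewrite lerXn2r ?nnegrE// norm_qval_le.
Qed.

Lemma disc_law_rev v : disc_law (rev_ord v) = disc_law v.
Proof.
rewrite /disc_law /law; congr fine.
transitivity (P ((fun w => - X w) @^-1` (quant n e @^-1` [set rev_ord v]))).
  exact: Xsym (measurable_quant e0 (rev_ord v)).
congr (P _); apply/seteqP; split=> w /=; rewrite quantN.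
  by move=> /rev_ord_inj.
by move=> ->.
Qed.

Lemma disc_law_tail (t : R) : t <= n%:R * e ->
  (P [set w | (t + e < `|X w|)%R] <=
    (\sum_v disc_law v * (t <= `|qval e v|)%R%:R)%:E)%E.
Proof.
move=> tn; rewrite -(prob_finite_valued P measurable_quant_rv (fun v => t <= `|qval e v|)%R).
apply: le_measure; rewrite ?inE.
- exact: measurable_norm_gt.
- exact: (measurable_finite_valued measurable_quant_rv (fun v => t <= `|qval e v|)%R).
- by move=> w /= tw; exact: quant_tail.
Qed.

End discretized_law.

Arguments disc_law {R d T P} X n e v.

(** * From the finite model to the random matrix *)

Lemma boole (R : realType) (d : measure_display) (T : measurableType d)
    (P : probability T R) (K : finType) (E : K -> set T) :
  (forall k, measurable (E k)) ->
  (P (\big[setU/set0]_k E k) <= \sum_k P (E k))%E.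
Proof.
move=> mE; elim: (index_enum K) => [|k s IH]; first by rewrite !big_nil measure0.
rewrite !big_cons; apply: (le_trans (measureU2 _ _ _)) => //.
  exact: bigsetU_measurable.
exact: leeD.
Qed.

(** Independence, applied to fibres of [phi] over the full index set, produces exactly the product
    weights summed by [pexp]. *)
Lemma joint_law (R : realType) (m N : nat) (d d' : measure_display)
    (T : measurableType d) (T' : measurableType d') (P : probability T R)
    (a : 'I_m -> 'I_N -> {RV P >-> R}) (P' : probability T' R) (X : {RV P' >-> R})
    (V : finType) (phi : R -> V) :
  random_matrix_model a X -> (forall v, measurable (phi @^-1` [set v])) ->
  forall v : {ffun 'I_N -> {ffun 'I_m -> V}},
  P ((fun w => [ffun i => [ffun j => phi (a j i w)]]) @^-1` [set v]) =
    (\prod_i \prod_j law P' (phi \o X) (v i j))%:E.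
Proof.
move=> [indep _ same _] mphi v.
pose B (ji : 'I_m * 'I_N) := phi @^-1` [set v ji.2 ji.1].
have mB ji : measurable (B ji) by exact: mphi.
have := indep [set: 'I_m * 'I_N]%SET B mB.
rewrite (_ : \bigcap_(i in _) _ =
    (fun w => [ffun i => [ffun j => phi (a j i w)]]) @^-1` [set v]); last first.
  apply/seteqP; split=> [w H|w /= Yv [j i] _]; last by rewrite /B/= -Yv !ffunE.
  apply/ffunP => i; apply/ffunP => j; rewrite !ffunE.
  by apply: (H (j, i)); rewrite /= finset.in_setT.
move=> ->; rewrite exchange_big/= pair_big/= -prodEFin.
apply: eq_big => [ji|[j i] _]; first by rewrite finset.in_setT.
rewrite (same j i _ (mB (j, i))) /law fineK// fin_num_measure//.
rewrite comp_preimage; exact: measurable_funPTI (mB (j, i)).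
Qed.

Lemma model_symmetric (R : realType) (m N : nat) (d d' : measure_display)
    (T : measurableType d) (T' : measurableType d') (P : probability T R)
    (a : 'I_m -> 'I_N -> {RV P >-> R}) (P' : probability T' R) (X : {RV P' >-> R}) :
  (0 < m)%N -> (0 < N)%N -> random_matrix_model a X -> symmetric_rv P' X.
Proof.
move=> m0 N0 [_ sym same _] B mB; pose i := Ordinal N0; pose j := Ordinal m0.
rewrite -(same j i _ mB) (sym j i _ mB).
have mNB : measurable ((fun x : R => - x) @^-1` B).
  by rewrite -[X in measurable X]setTI; exact: (@oppr_measurable R setT).
exact: (same j i _ mNB).
Qed.

(* Passing from the discretized entries [b] to [a] costs a factor 2. *)
Lemma quotient_perturbation (R : realType) (m N : nat) (Z : ('I_m -> R) -> Prop)
    (D e : R) (a b : 'I_N -> 'I_m -> R) : 0 < D -> 0 < e ->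
  (forall y, dot y y <= 1 -> Z y) ->
  (forall i j, `|a i j - b i j| <= e) -> D * (e * Num.sqrt m%:R) <= 1 / 2 ->
  (forall y z, Z z -> exists i, dot y z <= D * `|dot (b i) y|) ->
  forall y z, Z z -> exists i, dot y z <= 2 * D * `|dot (a i) y|.
Proof.
move=> D0 e0 Zunit ab De bq y z Zz; set r := Num.sqrt (dot y y).
have [y0|y0] := eqVneq (dot y y) 0.
  have [i _] := bq y z Zz; exists i.
  rewrite [leLHS]big1 => [|j _]; last by rewrite (dot_eq0 y0) mul0r.
  by rewrite mulr_ge0// mulr_ge0// ltW.
have r0 : 0 < r by rewrite sqrtr_gt0 lt_neqAle eq_sym y0 dot_ge0.
have r2 : dot y y = r * r by rewrite -expr2 sqr_sqrtr// dot_ge0.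
(* If [dot y z < |y|], then [y / |y|] replaces [z]; the quantization error [|y| / 2] is then at most
   half of [dot y z']. *)
have [z' [Zz' yz' rz']] : exists z', [/\ Z z', dot y z <= dot y z' & r <= dot y z'].
  have [yr|yr] := leP r (dot y z); first by exists z.
  have yE : dot y (fun j => r^-1 * y j) = r by rewrite dotC dotZl r2 mulKf// gt_eqF.
  exists (fun j => r^-1 * y j); rewrite yE; split=> //; last exact: ltW.
  by apply: Zunit; rewrite dotZl yE mulVf// gt_eqF.
have [i bi] := bq y z' Zz'; exists i; apply: (le_trans yz').
have m_ge0 : 0 <= m%:R :> R by [].
have errb : `|dot (b i) y| <= `|dot (a i) y| + e * Num.sqrt m%:R * r.
  have -> : dot (b i) y = dot (a i) y - dot (fun j => a i j - b i j) y.
    by rewrite dotBl; ring.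
  apply: (le_trans (ler_normB _ _)); rewrite lerD2l.
  have [m0|m0] := eqVneq m 0%N.
    rewrite [dot _ _]big1 ?normr0; first by rewrite mulr_ge0 ?(ltW r0)// mulr_ge0 ?(ltW e0)// sqrtr_ge0.
    by move=> [j jm] _; exfalso; rewrite m0 in jm.
  have sm0 : 0 < Num.sqrt m%:R :> R by rewrite sqrtr_gt0 ltr0n lt0n.
  have es0 : 0 < e * Num.sqrt m%:R by rewrite mulr_gt0.
  have aa : dot (fun j => a i j - b i j) (fun j => a i j - b i j) <= (e * Num.sqrt m%:R) ^+ 2.
    rewrite exprMn sqr_sqrtr//; apply: (@le_trans _ _ (\sum_(j < m) e ^+ 2)).
      apply: ler_sum => j _; rewrite -expr2 -[leLHS]real_normK ?num_real//.
      by rewrite lerXn2r ?nnegrE ?(ltW e0).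
    by rewrite sumr_const card_ord mulr_natr.
  rewrite ler_norml; apply/andP; split; last first.
    by apply: dot_le => //; rewrite expr2 r2.
  rewrite lerNl -mulN1r -dotZl; apply: dot_le => //; last by rewrite expr2 r2.
  by rewrite dotZl dotC dotZl; lra.
have : D * `|dot (b i) y| <= D * `|dot (a i) y| + D * (e * Num.sqrt m%:R) * r.
  by rewrite -mulrA -mulrDr ler_pM2l.
have : D * (e * Num.sqrt m%:R) * r <= 1 / 2 * r by rewrite ler_pM2r.
by rewrite -mulrA; lra.
Qed.

(** Common core of both cases. The tilts are required for every sufficiently fine and wide
    quantization, because mesh and range are fixed only afterwards, in terms of [m] and [N]. The
    unit ball must lie in [Z] only if [1 <= al], which [Ct * m <= N] provides. *)
Lemma l1_quotient_whp (R : realType) (C c : R) : 1 <= C -> 0 < c <= 1 ->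
  exists Ct : R, 1 <= Ct /\
  forall (m N : nat) (d : measure_display) (T : measurableType d)
    (P : probability T R) (a : 'I_m -> 'I_N -> {RV P >-> R})
    (d' : measure_display) (T' : measurableType d')
    (P' : probability T' R) (X : {RV P' >-> R})
    (Z : ('I_m -> R) -> Prop) (nrm : 'cV[R]_m -> R),
  (0 < m)%N -> (0 < N)%N -> random_matrix_model a X -> Ct * m%:R <= N%:R ->
  let al := Num.sqrt (ln (expR 1 * N%:R / m%:R)) in
  (1 <= al -> forall y, dot y y <= 1 -> Z y) ->
  (forall z, Z z -> dot z z <= al ^+ 2) ->
  (exists e0 M0 : R, 0 < e0 /\ forall (n : nat) (e : R), 0 < e <= e0 -> M0 <= n%:R * e ->
    forall z, Z z -> forall j, tiltable (disc_law X n e) (qval e) C c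
      (2 * expR (C * (scale C ^+ 2 * al ^+ 2))) (scale C * z j)) ->
  (forall w, 0 <= nrm w) -> (forall w, nrm w = 0 -> w = 0) ->
  (forall w, 0 < nrm w -> Z (fun j => al / nrm w * w j ord0)) ->
  with_prob_at_least P
    [set w | l1_quotient_property (scaled_matrix (fun j i => a j i : T -> R) w)
               (2 * quotient_const C c) nrm]
    (1 - 2 * expR (- (2 * m%:R))).
Proof.
move=> C1 c01; have c0 : 0 < c by case/andP: c01.
have [Ct [Ct1 level]] := probability_level C1 c01.
exists Ct; split=> // m N d T P a d' T' P' X Z nrm m0 N0 model CtN al Zunit0 Zal
  [e0 [M0 [e00 tilts]]] nrm0 nrm_eq0 nrmZ.
have mR0 : 0 < m%:R :> R by rewrite ltr0n.
have NR0 : 0 < N%:R :> R by rewrite ltr0n.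
have [] := level (N%:R / m%:R); first by rewrite ler_pdivlMr.
rewrite (mulrA (expR 1)) -/al => al1 [p [p0 pal ple num1 num2]].
have Zunit := Zunit0 al1.
set D := quotient_const C c; have D0 : 0 < D := quotient_const_gt0 C1 c01.
have sm0 : 0 < Num.sqrt m%:R :> R by rewrite sqrtr_gt0.
pose e := Num.min e0 (1 / (2 * (D * Num.sqrt m%:R))).
have den0 : 0 < 2 * (D * Num.sqrt m%:R) by rewrite mulr_gt0// mulr_gt0.
have e_gt0 : 0 < e by rewrite lt_min e00 divr_gt0.
have ee0 : 0 < e <= e0 by rewrite e_gt0 ge_min lexx.
have De : D * (e * Num.sqrt m%:R) <= 1 / 2.
  have : e <= 1 / (2 * (D * Num.sqrt m%:R)) by rewrite ge_min lexx orbT.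
  by rewrite ler_pdivlMr//; lra.
(* By Chebyshev and a union bound, some entry leaves the range [n * e >= M1] with probability at
   most [m * N / M1 = exp (- 2 m)]. *)
pose M1 := m%:R * N%:R * expR (2 * m%:R) : R.
have M11 : 1 <= M1.
  rewrite -[leLHS]mulr1 ler_pM//; first by rewrite -natrM ler1n muln_gt0 m0.
  by rewrite -[leLHS]expR0 ler_expR mulr_ge0.
pose n := (Num.truncn (Num.max M0 M1 / e)).+1.
have ne : Num.max M0 M1 <= n%:R * e by rewrite -ler_pdivrMr// ltW// truncnS_gt.
have [M0n M1n] : M0 <= n%:R * e /\ M1 <= n%:R * e by move: ne; rewrite ge_max => /andP[].
have [_ _ same [_ X2]] := model.
have Xsym := model_symmetric m0 N0 model.
pose i0 := Ordinal N0.
have [bad [Pbad badP]] := @finite_model_quotient R m N _ (disc_law X n e) (qval e) Z al C c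
  (scale C) (2 * expR (C * (scale C ^+ 2 * al ^+ 2))) p m0 N0 (disc_law_pmf X n e_gt0)
  (disc_law_second_moment X2 n e_gt0) al1 Zunit Zal (tilts n e ee0 M0n)
  (le_trans ler01 C1) c0 (scale_gt0 C1) (mulr_ge0 (ler0n _ 2) (expR_ge0 _))
  (mulr_ile1 (ltW c0) (ltW (scale_gt0 C1)) (proj2 (andP c01)) (scale_le1 C1))
  p0 pal ple num1 num2.
pose Y (w : T) : {ffun 'I_N -> {ffun 'I_m -> 'I_(n + n.+1)}} :=
  [ffun i => [ffun j => quant n e (a j i w)]].
have mquant v : measurable (quant n e @^-1` [set v]) by exact: measurable_quant.
have mY v : measurable (Y @^-1` [set v]).
  rewrite (_ : Y @^-1` _ = \bigcap_(ji in [set: 'I_m * 'I_N])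
      (a ji.1 ji.2 @^-1` (quant n e @^-1` [set v ji.2 ji.1]))).
    apply: fin_bigcap_measurable => [|ji _]; first exact: finite_finset.
    exact: measurable_funPTI (mquant _).
  apply/seteqP; split=> [w /= Yv [j i] _|w H]; first by rewrite /= -Yv !ffunE.
  by apply/ffunP => i; apply/ffunP => j; rewrite !ffunE; exact: (H (j, i)).
pose A := [set w | bad (Y w)].
have mA : measurable A by exact: (measurable_finite_valued mY bad).
have PA : (P A <= (expR (- (2 * m%:R)))%:E)%E.
  rewrite /A (prob_finite_valued P mY bad) lee_fin; apply: le_trans Pbad.
  rewrite /pexp le_eqVlt; apply/orP; left; apply/eqP.
  by apply: eq_bigr => v _; rewrite /law (joint_law model mquant).
pose big (ji : 'I_m * 'I_N) := [set w | (n%:R * e < `|a ji.1 ji.2 w|)%R].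
have mbig ji : measurable (big ji) by exact: measurable_norm_gt.
pose B := \big[setU/set0]_ji big ji.
have mB : measurable B by exact: bigsetU_measurable.
have ne0 : 0 < n%:R * e by apply: lt_le_trans M1n; exact: lt_le_trans M11.
have PB : (P B <= (expR (- (2 * m%:R)))%:E)%E.
  apply: (le_trans (boole P mbig)).
  apply: (@le_trans _ _ (\sum_(ji : 'I_m * 'I_N) (M1^-1)%:E)%E).
    apply: lee_sum => -[j i] _.
    have mNe : measurable [set x : R | n%:R * e < `|x|].
      have := measurable_scaled_norm_gt (n%:R * e) (@ltr01 R).
      by under [in X in X -> _]eq_set do rewrite mul1r.
    have -> : P (big (j, i)) = P' [set w | (n%:R * e < `|X w|)%R].
      exact: (same j i _ mNe).
    apply: (le_trans (second_moment_tail X2 ne0)); rewrite lee_fin.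
    have M10 : 0 < M1 by exact: lt_le_trans M11.
    rewrite lef_pV2 ?posrE ?exprn_gt0//; apply: (le_trans M1n).
    by rewrite expr2 ler_peMr ?(ltW ne0)// (le_trans M11).
  rewrite sumEFin lee_fin sumr_const card_prod !card_ord -[leLHS]mulr_natl natrM.
  rewrite /M1 invfM mulrA mulfV ?mul1r ?expRN//.
  by rewrite mulf_neq0 ?gt_eqF.
(* The factor 2 in the probability counts two failures: a bad quantized array, and an entry out of
   range. Off both, each entry is within [e] of its quantization. *)
exists (~` (A `|` B)); split.
- by apply: measurableC; exact: measurableU.
- move=> w nAB.
  have nA : ~~ bad (Y w) by apply/negP => bw; apply: nAB; left.
  have nB j i : `|a j i w| <= n%:R * e.
    rewrite leNgt; apply/negP => bw; apply: nAB; right.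
    by rewrite /B -bigcup_seq; exists (j, i) => //=; rewrite mem_index_enum.
  have ab i j : `|a j i w - qval e (Y w i j)| <= e.
    by rewrite !ffunE quant_err.
  have := quotient_perturbation D0 e_gt0 Zunit ab De (badP _ nA).
  move=> quo u; apply: l1_quotient_of_dual.
    by rewrite mulr_ge0// mulr_ge0 ?sqrtr_ge0// mulr_ge0// ltW.
  move=> y.
  have dotE i : dot (fun j => scaled_matrix (fun j i => a j i : T -> R) w j i) y =
      (Num.sqrt m%:R)^-1 * dot (fun j => a j i w) y.
    by rewrite -dotZl; apply: eq_bigr => j _; rewrite !mxE.
  have [u0|u0] := eqVneq (nrm u) 0.
    exists i0; rewrite u0 mulr0 mul0r (nrm_eq0 _ u0) [leLHS]big1// => j _.
    by rewrite mxE mulr0.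
  have {}u0 : 0 < nrm u by rewrite lt_neqAle eq_sym u0 nrm0.
  have [i yi] := quo y _ (nrmZ u u0); exists i.
  have al0 : 0 < al by exact: lt_le_trans al1.
  rewrite dotE normrM gtr0_norm ?invr_gt0//.
  have sE : Num.sqrt (s_star m N) = Num.sqrt m%:R / al :> R.
    by rewrite /s_star sqrtrM// sqrtrV// -/al; move: al0; rewrite sqrtr_gt0 => /ltW.
  move: yi; rewrite dotC dotZl (dotC _ y) sE => yi.
  have an0 : 0 < al / nrm u by rewrite divr_gt0.
  rewrite -(ler_pM2l an0); apply: (le_trans yi).
  rewrite le_eqVlt; apply/orP; left; apply/eqP.
  by rewrite -/D; field; rewrite !gt_eqF.
- rewrite probability_setC; last exact: measurableU.
  have PAB : (P (A `|` B) <= (2 * expR (- (2 * m%:R)))%:E)%E.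
    apply: (le_trans (measureU2 _ mA mB)).
    by rewrite mulr_natl mulr2n EFinD leeD.
  by rewrite EFinB leeB.
Qed.

(** * Tilts available for the quantized laws *)

Section tilts_of_discretized_laws.
Context {R : realType} {d : measure_display} {T : measurableType d}.
Variables (P : probability T R) (X : {RV P >-> R}).
Hypothesis X2 : ('E_P[fun w => (X w ^+ 2)%R] = 1)%E.
Hypothesis Xsym : symmetric_rv P X.
Variables (n : nat) (e : R).
Hypotheses (e01 : 0 < e <= 1 / 4) (ne : 1 / 4 <= n%:R * e).

Let e0 : 0 < e. Proof. by case/andP: e01. Qed.
Let e1 : e <= 1 / 4. Proof. by case/andP: e01. Qed.

Lemma disc_tail_ge (t u p : R) : t <= n%:R * e -> t + e <= u ->
  (p%:E <= P [set w | (u < `|X w|)%R])%E ->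
  p <= \sum_v disc_law X n e v * (t <= `|qval e v|)%R%:R.
Proof.
move=> tn tu pu; rewrite -lee_fin; apply: (le_trans pu).
apply: le_trans (disc_law_tail X e0 tn).
by apply: le_measure; rewrite ?inE; [exact: measurable_norm_gt..|move=> w /=; exact: le_lt_trans].
Qed.

(** A mesh of at most [1 / 4] sends [|X| > 1 / 2] to values of size at least [1 / 4], so the mean
    absolute value is at least [p / 4]. *)
Lemma disc_tiltable_small (p C V0 z : R) : 0 < p ->
  (p%:E <= P [set w | (1 / 2 < `|X w|)%R])%E -> 1 <= C -> 2 <= V0 -> `|z| <= 1 ->
  tiltable (disc_law X n e) (qval e) C (p / 4) V0 z.
Proof.
move=> p0 pX C1 V2 z1.
apply: (tiltable_small (disc_law_pmf X n e0) (disc_law_second_moment X2 n e0) (@rev_ordK _)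
  (disc_law_rev Xsym e0) (@qval_rev _ _ _)) => //; first by rewrite divr_gt0.
apply: (@le_trans _ _ (1 / 4 * \sum_v disc_law X n e v * (1 / 4 <= `|qval e v|)%R%:R)).
  rewrite mulrC mul1r ler_pM2l ?invr_gt0//.
  by apply: disc_tail_ge pX => //; move: e1 ne; lra.
rewrite big_distrr/=; apply: ler_sum => v _.
rewrite mulrCA ler_wpM2l ?(disc_law_pmf X n e0).1//.
by have [xv|_] := boolP (1 / 4 <= `|qval e v|)%R; rewrite ?mulr1 ?mulr0.
Qed.

(** The tail is taken at [2 * |z|] to absorb the mesh, whence [4 / sigma ^+ 2]; [2 / k] pays for the
    factor [k / 2], as [exp (- 2 / k) <= k / 2]; constants are absorbed through [z ^+ 2 >= 1]. *)
Lemma disc_tiltable_gaussian (sigma k c V0 z : R) : 0 < sigma -> 0 < k -> 0 < c <= 1 ->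
  (forall t, 0 < t ->
    ((k * expR (- (1 + (t / sigma) ^+ 2)))%:E <= P [set w | (t < `|X w|)%R])%E) ->
  let C := 2 + 4 / sigma ^+ 2 + 2 / k in
  1 <= `|z| -> `|z| <= n%:R * e -> expR (C * z ^+ 2) <= V0 ->
  tiltable (disc_law X n e) (qval e) C c V0 z.
Proof.
move=> s0 k0 c01 tail C z1 zn eV.
apply: (tiltable_large (disc_law_pmf X n e0) (disc_law_second_moment X2 n e0) (@rev_ordK _)
  (disc_law_rev Xsym e0) (@qval_rev _ _ _)) => //.
  by rewrite -normr_gt0 (lt_le_trans ltr01).
have z0 : 0 < `|z| by exact: lt_le_trans z1.
have z21 : 1 <= z ^+ 2 by rewrite -[leRHS]real_normK ?num_real// exprn_ege1.
have tz := tail (2 * `|z|) (mulr_gt0 (ltr0Sn _ 1) z0).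
have : k * expR (- (1 + (2 * `|z| / sigma) ^+ 2)) <=
    \sum_v disc_law X n e v * (`|z| <= `|qval e v|)%R%:R.
  by apply: disc_tail_ge tz => //; move: e1; lra.
rewrite (_ : (2 * `|z| / sigma) ^+ 2 = 4 / sigma ^+ 2 * z ^+ 2); last first.
  by rewrite -[in RHS](real_normK (num_real z)); field; rewrite gt_eqF.
set q := 4 / sigma ^+ 2; set S := \sum_v _ => kS.
have q0 : 0 <= q by rewrite divr_ge0 ?sqr_ge0.
have k20 : 0 < 2 / k by rewrite divr_gt0.
have ek : expR (- (2 / k)) <= k / 2.
  rewrite expRN -[leRHS]invrK lef_pV2 ?posrE ?expR_gt0 ?invr_gt0 ?divr_gt0// invf_div.
  by have := expR_ge1Dx (2 / k); lra.
apply: (@le_trans _ _ (expR (- (1 + q * z ^+ 2)) * (k / 2))); last by lra.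
apply: (@le_trans _ _ (expR (- (1 + q * z ^+ 2)) * expR (- (2 / k)))); last first.
  by rewrite ler_pM2l ?expR_gt0.
by rewrite -expRD ler_expR /C -/q; nra.
Qed.

End tilts_of_discretized_laws.

(** * Euclidean and maximum norms *)

Section norms.
Context {R : realType}.

Lemma dot_l2norm m (w : 'cV[R]_m) : dot (fun j => w j ord0) (fun j => w j ord0) = l2norm w ^+ 2.
Proof.
rewrite sqr_sqrtr; first by apply: eq_bigr => j _; rewrite expr2.
by apply: sumr_ge0 => j _; exact: sqr_ge0.
Qed.

Lemma l2norm_ge0 m (w : 'cV[R]_m) : 0 <= l2norm w. Proof. exact: sqrtr_ge0. Qed.

Lemma l2norm_eq0 m (w : 'cV[R]_m) : l2norm w = 0 -> w = 0.
Proof.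
move=> w0; apply/matrixP => j k; rewrite ord1 mxE.
by apply: (dot_eq0 (y := fun j => w j ord0)); rewrite dot_l2norm w0 expr0n.
Qed.

Lemma norm_coord_le (I : finType) (y : I -> R) (B : R) j : 0 <= B ->
  dot y y <= B ^+ 2 -> `|y j| <= B.
Proof.
move=> B0 yB; rewrite -(@ler_pXn2r _ 2)// ?nnegrE// real_normK ?num_real//.
apply: le_trans yB; rewrite /dot (bigD1 j)//= -expr2 lerDl.
by apply: sumr_ge0 => k _; rewrite -expr2 sqr_ge0.
Qed.

Lemma norm_le_linfnorm m (w : 'cV[R]_m) j : `|w j ord0| <= linfnorm w.
Proof. exact: (le_bigmax _ (fun j => `|w j ord0|)). Qed.

Lemma dot_normalized m (w : 'cV[R]_m) (al r : R) : 0 < r -> l2norm w <= r ->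
  dot (fun j => al / r * w j ord0) (fun j => al / r * w j ord0) <= al ^+ 2.
Proof.
move=> r0 wr; rewrite dotZl dotC dotZl dot_l2norm mulrA -expr2 expr_div_n mulrAC.
rewrite ler_pdivrMr ?exprn_gt0// ler_wpM2l ?sqr_ge0//.
by rewrite lerXn2r ?nnegrE ?l2norm_ge0// ltW.
Qed.

End norms.

Theorem theorem2p3 (R : realType) :
  (* (a) weak moment assumption *)
  (exists c0 : R, 0 < c0 /\
   forall kappa1 gamma : R, 1 / 2 <= gamma ->
   exists Ct D : R,
   forall (m N : nat) (d : measure_display) (T : measurableType d)
     (P : probability T R) (a : 'I_m -> 'I_N -> {RV P >-> R})
     (d' : measure_display) (T' : measurableType d')
     (P' : probability T' R) (X : {RV P' >-> R}),
     (0 < m)%N -> (0 < N)%N ->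
     random_matrix_model a X ->
     weak_moment P' X (Num.max 4 (ln (m%:R : R))) kappa1 gamma ->
     4 * expR (4 * gamma) * c0 ^+ 2 * kappa1 ^+ 2 * ln (m%:R : R) <= m%:R ->
     Num.max (Ct * m%:R) (ln (m%:R : R) `^ (2 * gamma - 1)) <= N%:R ->
     with_prob_at_least P
       [set w | l1_quotient_property (scaled_matrix (fun j i => a j i : T -> R) w) D
                  (clipped_norm (Num.sqrt (ln (expR 1 * N%:R / m%:R))) (n:=m))]
       (1 - 2 * expR (- (2 * m%:R))))
  /\
  (* (b) super-Gaussian entries *)
  (forall sigma : R, 0 < sigma <= 1 ->
   exists Ct D : R,
   forall (m N : nat) (d : measure_display) (T : measurableType d)
     (P : probability T R) (a : 'I_m -> 'I_N -> {RV P >-> R})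
     (d' : measure_display) (T' : measurableType d')
     (P' : probability T' R) (X : {RV P' >-> R}),
     (0 < m)%N -> (0 < N)%N ->
     random_matrix_model a X ->
     super_gaussian P' X sigma ->
     Ct * m%:R <= N%:R ->
     with_prob_at_least P
       [set w | l1_quotient_property (scaled_matrix (fun j i => a j i : T -> R) w) D
                  (@l2norm R m)]
       (1 - 2 * expR (- (2 * m%:R)))).
Proof.
split.
  exists 1; split=> // kappa1 gamma _.
  pose K := kappa1 * 4 `^ gamma.
  pose p := 1 / (2 * (4 * K ^+ 4 + 1)).
  have K40 : 0 <= K ^+ 4 by rewrite exprn_even_ge0.
  have den : 1 <= 2 * (4 * K ^+ 4 + 1) by lra.
  have p0 : 0 < p by rewrite divr_gt0// (lt_le_trans ltr01).
  have p1 : p <= 1 by rewrite ler_pdivrMr ?(lt_le_trans ltr01)// mul1r.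
  have c01 : 0 < p / 4 <= 1 by lra.
  have [Ct [Ct1 whp]] := l1_quotient_whp (lexx 1) c01.
  exists Ct, (2 * quotient_const 1 (p / 4)) => m N d T P a d' T' P' X m0 N0 model moment _.
  rewrite ge_max => /andP[CtN _].
  set al := Num.sqrt _.
  have al0 : 0 <= al by exact: sqrtr_ge0.
  (* The clipped unit ball magnified by [al]: clipping bounds all coordinates by 1, so the sign tilt
     serves each of them. *)
  pose Z (z : 'I_m -> R) := dot z z <= al ^+ 2 /\ forall j, `|z j| <= 1.
  have [_ _ _ [_ X2]] := model.
  have Xsym := model_symmetric m0 N0 model.
  have l2_clip (w : 'cV[R]_m) : l2norm w <= clipped_norm al w by rewrite /clipped_norm le_max lexx.
  apply: (whp m N d T P a d' T' P' X Z) => //; rewrite -/al.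
  - move=> al1 y y1; split; first by apply: (le_trans y1); exact: exprn_ege1.
    by move=> j; apply: norm_coord_le => //; rewrite expr1n.
  - by move=> z [].
  - exists (1 / 4), (1 / 4); split=> // n e e01 ne z [_ z1] j.
    apply: disc_tiltable_small => //.
    + by apply: fourth_moment_tail => //; apply: moment; rewrite lexx le_max lexx.
    + rewrite -[leLHS]mulr1 ler_pM2l// -[leLHS]expR0 ler_expR mul1r -exprMn; exact: sqr_ge0.
    + rewrite normrM mulr_ile1// gtr0_norm; first exact: scale_le1.
      exact: scale_gt0.
  - by move=> w; exact: le_trans (l2norm_ge0 w) (l2_clip w).
  - move=> w w0; apply: l2norm_eq0; apply/eqP.
    by rewrite eq_le l2norm_ge0 andbT -w0 l2_clip.
  - move=> w w0; split; first exact: dot_normalized.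
    move=> j; rewrite normrM ger0_norm ?divr_ge0 ?(ltW w0)// mulrAC ler_pdivrMr// mul1r.
    apply: (@le_trans _ _ (al * linfnorm w)).
      by rewrite ler_wpM2l// norm_le_linfnorm.
    by rewrite /clipped_norm le_max lexx orbT.
move=> sigma /andP[s0 _].
pose k : R := normal_peak 1.
have k0 : 0 < k by rewrite normal_peak_gt0// oner_eq0.
pose C := 2 + 4 / sigma ^+ 2 + 2 / k.
have C1 : 1 <= C.
  have : 0 <= 4 / sigma ^+ 2 by rewrite divr_ge0 ?sqr_ge0.
  have : 0 < 2 / k by rewrite divr_gt0.
  by rewrite /C; lra.
pose p := Num.min 1 (k * expR (- (1 + (1 / 2 / sigma) ^+ 2))).
have p0 : 0 < p by rewrite lt_min ltr01 mulr_gt0 ?expR_gt0.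
have p1 : p <= 1 by rewrite ge_min lexx.
have c01 : 0 < p / 4 <= 1 by lra.
have [Ct [Ct1 whp]] := l1_quotient_whp C1 c01.
exists Ct, (2 * quotient_const C (p / 4)) => m N d T P a d' T' P' X m0 N0 model super CtN.
have [_ _ _ [_ X2]] := model.
have Xsym := model_symmetric m0 N0 model.
have tail t : 0 < t ->
    ((k * expR (- (1 + (t / sigma) ^+ 2)))%:E <= P' [set w | (t < `|X w|)%R])%E.
  by move=> t0; apply: le_trans (super t t0); exact: normal_tail.
apply: (whp m N d T P a d' T' P' X
  (fun z => dot z z <= (Num.sqrt (ln (expR 1 * N%:R / m%:R))) ^+ 2)) => //.
- by move=> al1 y y1; apply: (le_trans y1); exact: exprn_ege1.
- set al := Num.sqrt _; have al0 : 0 <= al by exact: sqrtr_ge0.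
  (* The range must reach [al], which bounds the coordinates in the ball, so that the Gaussian tail
     survives saturation there. *)
  exists (1 / 4), (1 / 4 + al); split=> // n e e01 ne z zal j.
  have ne4 : 1 / 4 <= n%:R * e by lra.
  have zj : `|z j| <= al by exact: norm_coord_le.
  have s1 := scale_le1 C1; have s00 := scale_gt0 C1.
  have V02 : C * (scale C * z j) ^+ 2 <= C * (scale C ^+ 2 * al ^+ 2).
    rewrite ler_pM2l ?(lt_le_trans ltr01)// exprMn ler_pM2l ?exprn_gt0//.
    by rewrite -[leLHS]real_normK ?num_real// lerXn2r ?nnegrE.
  (* Small coordinates take the sign tilt, large ones the tilt by conditioning on a tail; both
     achieve the same [c = p / 4]. *)
  have [small|large] := leP `|scale C * z j| 1.
    apply: disc_tiltable_small => //.
      apply: le_trans (tail (1 / 2) _); last by [].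
      by rewrite lee_fin ge_min lexx orbT.
    rewrite -[leLHS]mulr1 ler_pM2l// -[leLHS]expR0 ler_expR mulr_ge0 ?(le_trans ler01 C1)//.
    by rewrite -exprMn sqr_ge0.
  apply: (disc_tiltable_gaussian X2 Xsym e01 s0 k0 c01 tail); first exact: ltW.
    rewrite normrM gtr0_norm//; have : scale C * `|z j| <= `|z j| by rewrite ler_piMl.
    by lra.
  apply: (@le_trans _ _ (expR (C * (scale C ^+ 2 * al ^+ 2)))); first by rewrite ler_expR.
  by rewrite ler_peMl ?expR_ge0// ler1n.
- by move=> w; exact: l2norm_ge0.
- exact: l2norm_eq0.
- by move=> w w0; exact: dot_normalized.
Qed.
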